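(* Let $(L,A)$ be an SH Lie pair and let $E$ be an $A$-module. For every $L$-connection $\nabla$ on $E$ extending $(A,E)$, the degree $2$ element $\alpha^E_\nabla=(J\otimes 1)(R^\nabla)\in\mathcal{O}(A)\otimes A^\perp\otimes\mathrm{End}(E)$ is a cocycle of the Chevalley–Eilenberg complex of $A$ with coefficients in $A^\perp\otimes\mathrm{End}(E)$, and its cohomology class (the Atiyah class) $$[\alpha^E_\nabla]\in \mathrm{H}^2_{\mathrm{CE}}(A,A^\perp\otimes \mathrm{End}(E))$$ is canonical, i.e. independent of the choice of the $L$-connection $\nabla$ extending $(A,E)$. In particular, to the canonical $A$-module $L/A$ there is associated a canonical Atiyah class $$[\alpha^{L/A}]\in \mathrm{H}^2_{\mathrm{CE}}(A,A^\perp\otimes\mathrm{End}(L/A))=\mathrm{H}^2_{\mathrm{CE}}(A,\mathrm{Hom}(L/A\otimes L/A,L/A)).$$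
   Context: Conventions. $\mathbb{K}$ is a field of characteristic zero; graded means $\mathbb{Z}$-graded; $|v|$ is the degree of $v$; $V^\vee$ is the graded dual, $(V^\vee)^n=(V^{-n})^*$; graded vector spaces whose duals are used are finite-dimensional. $\mathrm{Hom}(V,W)\cong V^\vee\otimes W$ via $(\xi\otimes w)(v)=(-1)^{|v||w|}\xi(v)w$. $\mathcal{O}(V)=\prod_{n\ge 0}S^n(V^\vee)$ is the algebra of formal power series on $V$ (completed graded symmetric algebra, product formed degree by degree), with product $\odot$. Elements of $\mathcal{O}(V)\otimes\mathrm{Hom}(E,F)$ are regarded as $\mathcal{O}(V)$-linear maps $\mathcal{O}(V)\otimes E\to\mathcal{O}(V)\otimes F$ by $(\omega\otimes\phi)(\eta\otimes e)=(-1)^{|\phi||\eta|}\omega\odot\eta\otimes\phi(e)$; $\circ$ is composition and $[-,-]$ the graded commutator; the Koszul sign rule is used throughout (in particular when $\mathcal{O}(A)\otimes\mathrm{End}(E)$ acts by left and right composition on $\mathcal{O}(A)\otimes W\otimes\mathrm{End}(E)$). $L_\infty[1]$-algebras. An $L_\infty[1]$-algebra (SH Lie algebra) is a graded vector space $L$ with degree $1$ maps $\lambda_k:S^k(L)\to L$, $k\ge 0$, such that for all $n\geq 0$, $\sum_{k+l=n}\sum_{\sigma\in \mathrm{sh}(l,k)}\epsilon(\sigma)\lambda_{k+1}(\lambda_l(u_{\sigma(1)},\dots,u_{\sigma(l)}),u_{\sigma(l+1)},\dots,u_{\sigma(n)})=0$ ($\mathrm{sh}(l,k)$: $(l,k)$-unshuffles,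 $\epsilon(\sigma)$: Koszul sign). Equivalently it is a degree $1$ derivation $Q_L$ of $\mathcal{O}(L)$ with $Q_L^2=0$, the relation being $\langle\xi,\lambda_k(u_1,\dots,u_k)\rangle=(-1)^{|\xi|+k}\langle Q_L(\xi),u_1\odot\cdots\odot u_k\rangle$ for $\xi\in L^\vee$; here, for $x\in S^k(L^\vee)$, $\langle x,u_1\odot\cdots\odot u_k\rangle=x\llcorner u_1\cdots\llcorner u_k$ with $\llcorner u$ given by $\xi\llcorner u=\xi(u)$ and $(\xi\odot\eta)\llcorner u=(-1)^{|u||\eta|}(\xi\llcorner u)\odot\eta+\xi\odot(\eta\llcorner u)$ (only the $S^k$-component of $Q_L(\xi)$ contributes). SH Lie pairs. An SH Lie pair $(L,A)$ is an $L_\infty[1]$-algebra $L$ with a subalgebra $A\subset L$, i.e. a graded subspace with $\lambda_k(A,\dots,A)\subset A$ for all $k\ge0$ (so $\lambda_0\in A$). Let $j:A\to L$ be the inclusion and $j^\vee:\mathcal{O}(L)\to\mathcal{O}(A)$ the restriction; $Q_A$ is the homological vector field of $A$, so $j^\vee\circ Q_L=Q_A\circ j^\vee$. Put $B=L/A$ and $A^\perp=\ker(j^\vee:L^\vee\to A^\vee)\cong B^\vee$. For a graded vector space $V$, $I^V:\mathcal{O}(V)\to\mathcal{O}(V)\otimes V^\vee$ is the algebraic de Rham operator: $I^V(1)=0$, $I^V(\xi)=1\otimes\xi$ for $\xi\in V^\vee$ and $I^V(\omega\odot\omega')=\omega\odot I^V(\omega')+(-1)^{|\omega||\omega'|}\omega'\odot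 I^V(\omega)$. Define $J=(j^\vee\otimes 1)\circ I^L:\mathcal{O}(L)\to\mathcal{O}(A)\otimes L^\vee$. Modules. An $A$-module is a graded vector space $E$ with $D^{A,E}\in(\mathcal{O}(A)\otimes\mathrm{End}(E))^1$ such that $\partial_A^E=Q_A+D^{A,E}$, i.e. $\partial_A^E(\omega\otimes e)=Q_A(\omega)\otimes e+(-1)^{|\omega|}\omega\odot D^{A,E}(e)$, satisfies $(\partial_A^E)^2=0$; $\mathrm{H}^\bullet_{\mathrm{CE}}(A,E)=\mathrm{H}^\bullet(\mathcal{O}(A)\otimes E,\partial_A^E)$. The canonical $A$-module structure on $B$ is the one induced by $m_k(a_1,\dots,a_{k-1},p(l))=p(\lambda_k(a_1,\dots,a_{k-1},l))$, $p:L\to B$ the projection; its dual on $A^\perp\cong B^\vee$ is $\partial_A^\perp=Q_A+D^\perp$ with $D^\perp(\xi)=J(Q_L(\xi))$ for $\xi\in A^\perp$, and $\partial_A^B$ is determined by $\langle\partial_A^\perp f,g\rangle=Q_A\langle f,g\rangle-(-1)^{|f|}\langle f,\partial_A^Bg\rangle$. On $A^\perp\otimes\mathrm{End}(E)$ the differential is $Q_A+D^\perp+[D^{A,E},-]$. Connections. An $L$-connection on $E$ extending $(A,E)$ is an operator $\nabla=Q_L+D^{L,E}$ on $\mathcal{O}(L)\otimes E$ with $D^{L,E}\in(\mathcal{O}(L)\otimes\mathrm{End}(E))^1$ and $(j^\vee\otimes1)(D^{L,E})=D^{A,E}$. Its curvature is $R^\nabla=\nabla^2=Q_L(D^{L,E})+(D^{L,E})^2\in\mathcal{O}(L)\otimes\mathrm{End}(E)$.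 Since $(j^\vee\otimes 1)(R^\nabla)=0$, $(J\otimes1)(R^\nabla)$ lies in $\mathcal{O}(A)\otimes A^\perp\otimes\mathrm{End}(E)$. *)

(* Defs.v *)
From mathcomp Require Import all_boot all_order all_algebra.
From mathcomp Require Import boolp classical_sets functions.
From mathcomp Require Import ring.

Set Implicit Arguments.
Unset Strict Implicit.
Unset Printing Implicit Defensive.

Import GRing.Theory.
Local Open Scope ring_scope.

(* Graded vector spaces are finite-dimensional and Z-graded.  As usual,       *)
(* graded maps are specified on homogeneous vectors: an element of            *)
(* O(U) (x) W = prod_n S^n(U^v) (x) W is represented by the family of its     *)
(* contractions, that is by the function                                      *)
(*     f : seq (hvec U) -> W,   [:: u_1; ...; u_n] |-> <f, u_1 ... u_n>,      *)
(* where <omega (x) w, u_1 ... u_n> = <omega, u_1 ... u_n> w (no sign) and    *)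
(* <x, u_1 ... u_n> = x _| u_1 ... _| u_n.  In characteristic zero and finite *)
(* dimension this identifies S^n(U^v) (x) W with the graded symmetric         *)
(* n-linear maps from U to W (predicate [in_O] below).  In particular         *)
(* x _| u is the function s |-> x (u :: s), and if omega has degree d then    *)
(* <omega, u_1 ... u_n> vanishes unless |u_1| + ... + |u_n| = - d.            *)

Section GradedSpaces.
Variable K : fieldType.

Definition ksign (n : int) : K := (-1) ^ n.

Record gvect := GVect {
  gcar :> vectType K;
  gpart : int -> {vspace gcar};
  gsupp : seq int;
  gsupp_uniq : uniq gsupp;
  gpart_out : forall d, d \notin gsupp -> gpart d = 0%VS;
  gpart_span : (\sum_(d <- gsupp) gpart d)%VS = fullv;
  gpart_free : forall u : int -> gcar, (forall d, u d \in gpart d) ->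
    \sum_(d <- gsupp) u d = 0 -> forall d, d \in gsupp -> u d = 0 }.

(* Homogeneous vectors of V lying in the subspace U. *)
Record hvec (V : gvect) (U : {vspace V}) := HVec {
  hdeg : int;
  hval : V;
  hvalP : hval \in (gpart V hdeg :&: U)%VS }.

Definition graded_subspace (V : gvect) (U : {vspace V}) : bool :=
  (U <= \sum_(d <- gsupp V) (gpart V d :&: U))%VS.

Lemma hincl_subproof (V : gvect) (U : {vspace V}) (u : hvec U) :
  hval u \in (gpart V (hdeg u) :&: fullv)%VS.
Proof. by have := hvalP u; rewrite !memv_cap memvf andbT => /andP[]. Qed.

Definition hincl (V : gvect) (U : {vspace V}) (u : hvec U) : hvec {:V} :=
  HVec (hincl_subproof u).

End GradedSpaces.

Section Series.
Variables (K : fieldType) (V : gvect K) (U : {vspace V}).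
Implicit Types (s : seq (hvec U)) (W : lmodType K).
Local Notation ksign := (ksign K).

Definition sdeg s : int := \sum_(u <- s) hdeg u.

(* All (l, k)-unshuffles of s, l + k = size s: each entry (e, (s1, s2))       *)
(* consists of the first l and the last k terms of the unshuffled sequence    *)
(* and of its Koszul sign e; prepending u to s2 moves u past all of s1.       *)
Fixpoint unshuffles s : seq (K * (seq (hvec U) * seq (hvec U))) :=
  if s is u :: s' then
    [seq (x.1, (u :: x.2.1, x.2.2)) | x <- unshuffles s'] ++
    [seq (x.1 * ksign (hdeg u * sdeg x.2.1), (x.2.1, u :: x.2.2))
       | x <- unshuffles s']
  else [:: (1, ([::], [::]))].

Definition hlinear W (psi : hvec U -> W) : Prop :=
  forall (a : K) (u v w : hvec U), hdeg u = hdeg w -> hdeg v = hdeg w ->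
  hval w = a *: hval u + hval v -> psi w = a *: psi u + psi v.

Definition multilinear W (f : seq (hvec U) -> W) : Prop :=
  forall s1 s2, hlinear (fun u => f (s1 ++ u :: s2)).

Definition gsymmetric W (f : seq (hvec U) -> W) : Prop :=
  forall s1 s2 (u v : hvec U),
  f (s1 ++ u :: v :: s2) =
    ksign (hdeg u * hdeg v) *: f (s1 ++ v :: u :: s2).

(* f is in (O(U) (x) W)^n, where Wdeg k w means that w has degree k. *)
Record in_O W (Wdeg : int -> W -> Prop) (n : int) (f : seq (hvec U) -> W) :
  Prop := InO {
  in_O_multi : multilinear f;
  in_O_sym : gsymmetric f;
  in_O_deg : forall s, Wdeg (n + sdeg s) (f s) }.

(* The O(U)-bilinear extension of a pairing mu : W1 x W2 -> W3 of degree 0,   *)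
(*   (omega (x) w1) . (eta (x) w2)                                            *)
(*     = (-1)^(|w1||eta|) (omega o. eta) (x) mu w1 w2,                        *)
(* for a first factor F of degree p.  Contracting with the unshuffle (s1, s2) *)
(* gives the signs (-1)^(|s1||eta|) from the contraction rule and             *)
(* (-1)^(|w1||eta|), where |eta| = - |s2| and |w1| = p + |s1|; their product  *)
(* is (-1)^(p|s2|).  For W1 = W2 = W3 = K this is the product of O(U), see    *)
(* odot_contraction and odotC.                                                *)
Definition oprod (W1 W2 W3 : lmodType K) (mu : W1 -> W2 -> W3) (p : int)
    (F : seq (hvec U) -> W1) (G : seq (hvec U) -> W2) (s : seq (hvec U)) : W3 :=
  \sum_(x <- unshuffles s)
    (x.1 * ksign (p * sdeg x.2.2)) *: mu (F x.2.1) (G x.2.2).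

(* The vector field of a family lam of brackets on U, acting on O(U) (x) W as *)
(* Q (x) 1.  Here Q is the degree 1 derivation of O(U) determined by          *)
(*   <xi, lam_k(u_1, ..., u_k)> = (-1)^(|xi| + k) <Q xi, u_1 ... u_k>,        *)
(* see vfield_linform and vfield_oprod; on omega in O(U) it is                *)
(*   <Q omega, s> = (-1)^|omega| sum +/- (-1)^l <omega, lam_l(s1) s2>,        *)
(* and |omega| = |s| + 1 mod 2 for the non-zero terms.                        *)
Definition vfield (lam : seq (hvec U) -> hvec U) W (f : seq (hvec U) -> W)
    (s : seq (hvec U)) : W :=
  ksign (sdeg s + 1) *:
    \sum_(x <- unshuffles s)
      (x.1 * (-1) ^+ size x.2.1) *: f (lam x.2.1 :: x.2.2).

(* A linear map U -> W as an element of U^v (x) W, inside O(U) (x) W. *)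
Definition linform W (psi : hvec U -> W) (s : seq (hvec U)) : W :=
  if s is [:: u] then psi u else 0.

(* The algebraic de Rham operator O(U) (x) W -> O(U) (x) U^v (x) W; see       *)
(* deRham1, deRham_linform and deRham_odot.                                   *)
Definition deRham W (f : seq (hvec U) -> W) (s : seq (hvec U)) (v : hvec U) : W
  := f (v :: s).

End Series.

Section Degrees.
Variable K : fieldType.

Definition scalar_deg (k : int) (x : K^o) : Prop := k != 0 -> x = 0.

Definition vect_deg (E : gvect K) (k : int) (e : E) : Prop := e \in gpart E k.

Definition end_deg (E : gvect K) (k : int) (phi : 'End(E)) : Prop :=
  forall d, (phi @: gpart E d <= gpart E (d + k))%VS.

Definition hom_deg (V : gvect K) (W : lmodType K) (Wdeg : int -> W -> Prop)
    (k : int) (psi : hvec {:V} -> W) : Prop :=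
  hlinear psi /\ forall v, Wdeg (k + hdeg v) (psi v).

(* A^perp (x) W, realised as the linear maps V -> W vanishing on A through    *)
(* xi (x) w |-> (v |-> xi(v) w).                                              *)
Definition perp_deg (V : gvect K) (A : {vspace V}) (W : lmodType K)
    (Wdeg : int -> W -> Prop) (k : int) (psi : hvec {:V} -> W) : Prop :=
  hom_deg Wdeg k psi /\ forall v, hval v \in A -> psi v = 0.

End Degrees.

Section VectorFields.
Variables (K : fieldType) (V : gvect K) (U : {vspace V}).
Implicit Types (s : seq (hvec U)) (u v : hvec U) (W : lmodType K).
Local Notation ksign := (ksign K).

Lemma ksignD m n : ksign (m + n) = ksign m * ksign n.
Proof. by rewrite /ksign expfzDr ?oppr_eq0 ?oner_eq0. Qed.

Lemma ksign0 : ksign 0 = 1. Proof. by []. Qed.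

Lemma ksign1 : ksign 1 = -1. Proof. by []. Qed.

Lemma ksignK n : ksign n * ksign n = 1.
Proof. by rewrite /ksign -expfzMl mulrNN mulr1 exp1rz. Qed.

Lemma ksign_eq (k m n : int) : m = n + (k + k) -> ksign m = ksign n.
Proof. by move=> ->; rewrite !ksignD ksignK mulr1. Qed.

Lemma ksignMS n : ksign (n * (n + 1)) = 1.
Proof.
have /eqP := ksignK n; rewrite -expr2 sqrf_eq1 /ksign -exprz_exp.
case/orP=> /eqP n1; rewrite n1 ?exp1rz //.
by rewrite -/(ksign _) ksignD /ksign n1 expr1z mulrNN mulr1.
Qed.

Lemma sdeg_nil : sdeg ([::] : seq (hvec U)) = 0.
Proof. by rewrite /sdeg big_nil. Qed.

Lemma sdeg_cons u s : sdeg (u :: s) = hdeg u + sdeg s.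
Proof. by rewrite /sdeg big_cons. Qed.

Lemma sum_unshuffles_nil (M : nmodType)
    (Phi : K * (seq (hvec U) * seq (hvec U)) -> M) :
  \sum_(x <- unshuffles [::]) Phi x = Phi (1, ([::], [::])).
Proof. by rewrite big_seq1. Qed.

Lemma sum_unshuffles_cons (M : nmodType)
    (Phi : K * (seq (hvec U) * seq (hvec U)) -> M) u s :
  \sum_(x <- unshuffles (u :: s)) Phi x =
    \sum_(x <- unshuffles s) Phi (x.1, (u :: x.2.1, x.2.2)) +
    \sum_(x <- unshuffles s)
      Phi (x.1 * ksign (hdeg u * sdeg x.2.1), (x.2.1, u :: x.2.2)).
Proof. by rewrite /= big_cat !big_map. Qed.

Lemma eq_unshuffles (M : nmodType) s
    (Phi Psi : K * (seq (hvec U) * seq (hvec U)) -> M) :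
  (forall x, sdeg x.2.1 + sdeg x.2.2 = sdeg s -> Phi x = Psi x) ->
  \sum_(x <- unshuffles s) Phi x = \sum_(x <- unshuffles s) Psi x.
Proof.
elim: s Phi Psi => [|u s IHs] Phi Psi eqP.
  by rewrite !sum_unshuffles_nil eqP //= !sdeg_nil addr0.
rewrite !sum_unshuffles_cons; congr (_ + _); apply: IHs => x /= Dx;
  apply: eqP; rewrite /= !sdeg_cons -Dx; first by rewrite addrA.
by rewrite addrCA.
Qed.

Definition gtwist W (d : int) (f : seq (hvec U) -> W) (t : seq (hvec U)) : W :=
  ksign (d * sdeg t) *: f t.

Lemma gsym_cons W (f : seq (hvec U) -> W) u :
  gsymmetric f -> gsymmetric (fun t => f (u :: t)).
Proof. by move=> fS s1; apply: (fS (u :: s1)). Qed.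

Lemma sdeg_cat s1 s2 : sdeg (s1 ++ s2) = sdeg s1 + sdeg s2.
Proof. by rewrite /sdeg big_cat. Qed.

Lemma gsym_twist W d (f : seq (hvec U) -> W) :
  gsymmetric f -> gsymmetric (gtwist d f).
Proof.
move=> fS s1 s2 u v; rewrite /gtwist fS !scalerA; congr (_ *: _).
by rewrite !(sdeg_cat, sdeg_cons) mulrC (addrCA (hdeg u)).
Qed.

Definition insertion (lam : seq (hvec U) -> hvec U) W (f : seq (hvec U) -> W)
    (s : seq (hvec U)) : W :=
  \sum_(x <- unshuffles s) (x.1 * (-1) ^+ size x.2.1) *: f (lam x.2.1 :: x.2.2).

Lemma vfieldE lam W (f : seq (hvec U) -> W) s :
  vfield lam f s = ksign (sdeg s + 1) *: insertion lam f s.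
Proof. by []. Qed.

Lemma insertion_nil lam W (f : seq (hvec U) -> W) :
  insertion lam f [::] = f [:: lam [::]].
Proof. by rewrite /insertion sum_unshuffles_nil /= mulr1 scale1r. Qed.

Lemma insertion_cons (c : int) lam W (f : seq (hvec U) -> W) u s :
    (forall t, hdeg (lam t) = sdeg t + c) -> gsymmetric f ->
  insertion lam f (u :: s) =
    -1 *: insertion (fun t => lam (u :: t)) f s +
    ksign (c * hdeg u) *: insertion lam (fun t => f (u :: t)) s.
Proof.
move=> lamc fS; rewrite /insertion sum_unshuffles_cons; congr (_ + _).
  rewrite scaler_sumr; apply: eq_bigr => x _ /=.
  by rewrite exprS scalerA mulrCA.
rewrite scaler_sumr; apply: eq_bigr => x _ /=.
rewrite (fS [::]) /= lamc !scalerA; congr (_ *: _).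
rewrite mulrDl ksignD; have := ksignK (hdeg u * sdeg x.2.1).
by rewrite (mulrC (sdeg _)) => uK; rewrite -[RHS]mul1r -uK; ring.
Qed.

Section Product.
Variables (W1 W2 W3 : lmodType K) (mu : W1 -> W2 -> W3).
Hypothesis muDl : forall a x y z, mu (a *: x + y) z = a *: mu x z + mu y z.
Hypothesis muDr : forall a x y z, mu z (a *: x + y) = a *: mu z x + mu z y.
Implicit Types (F : seq (hvec U) -> W1) (G : seq (hvec U) -> W2).

Lemma mu0l z : mu 0 z = 0.
Proof.
have := muDl 1 0 0 z; rewrite !scale1r addr0 => /eqP.
by rewrite eq_sym -subr_eq0 addrK => /eqP.
Qed.

Lemma mu0r z : mu z 0 = 0.
Proof.
have := muDr 1 0 0 z; rewrite !scale1r addr0 => /eqP.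
by rewrite eq_sym -subr_eq0 addrK => /eqP.
Qed.

Lemma muZl a x z : mu (a *: x) z = a *: mu x z.
Proof. by have := muDl a x 0 z; rewrite !addr0 mu0l addr0. Qed.

Lemma muZr a x z : mu z (a *: x) = a *: mu z x.
Proof. by have := muDr a x 0 z; rewrite !addr0 mu0r addr0. Qed.

Lemma oprod_nil p F G : oprod mu p F G [::] = mu (F [::]) (G [::]).
Proof.
by rewrite /oprod sum_unshuffles_nil /= sdeg_nil mulr0 ksign0 mulr1 scale1r.
Qed.

Lemma oprod_cons p F G u s :
  oprod mu p F G (u :: s) =
    oprod mu p (fun t => F (u :: t)) G s +
    ksign (p * hdeg u) *:
      oprod mu p (fun t => ksign (hdeg u * sdeg t) *: F t)
                 (fun t => G (u :: t)) s.
Proof.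
rewrite /oprod sum_unshuffles_cons; congr (_ + _).
rewrite scaler_sumr; apply: eq_bigr => x _ /=.
by rewrite muZl !scalerA sdeg_cons mulrDr ksignD; congr (_ *: _); ring.
Qed.

Lemma eq_oprod p F1 F2 G1 G2 s :
  F1 =1 F2 -> G1 =1 G2 -> oprod mu p F1 G1 s = oprod mu p F2 G2 s.
Proof. by move=> eF eG; apply: eq_bigr => x _; rewrite eF eG. Qed.

Lemma oprodDl p a F F' G s :
  oprod mu p (fun t => a *: F t + F' t) G s =
    a *: oprod mu p F G s + oprod mu p F' G s.
Proof.
rewrite /oprod scaler_sumr -big_split; apply: eq_bigr => x _ /=.
by rewrite muDl scalerDr !scalerA (mulrC a).
Qed.

Lemma oprodDr p a F G G' s :
  oprod mu p F (fun t => a *: G t + G' t) s =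
    a *: oprod mu p F G s + oprod mu p F G' s.
Proof.
rewrite /oprod scaler_sumr -big_split; apply: eq_bigr => x _ /=.
by rewrite muDr scalerDr !scalerA (mulrC a).
Qed.

Lemma oprodZl p a F G s :
  oprod mu p (fun t => a *: F t) G s = a *: oprod mu p F G s.
Proof.
rewrite /oprod scaler_sumr; apply: eq_bigr => x _ /=.
by rewrite muZl !scalerA (mulrC a).
Qed.

Lemma oprodZr p a F G s :
  oprod mu p F (fun t => a *: G t) s = a *: oprod mu p F G s.
Proof.
rewrite /oprod scaler_sumr; apply: eq_bigr => x _ /=.
by rewrite muZr !scalerA (mulrC a).
Qed.

Lemma oprod_sym p F G :
  gsymmetric F -> gsymmetric G -> gsymmetric (oprod mu p F G).
Proof.
move=> FS GS s1; elim: s1 F G FS GS => [|w s1 IHs] F G FS GS s2 u v /=.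
  rewrite !oprod_cons /= !scalerDr -!addrA; congr (_ + _).
    by rewrite -oprodZl; apply: eq_oprod => // t; apply: (FS [::]).
  rewrite addrCA; congr (_ + (_ + _)); rewrite ?scalerA -?oprodZl.
  - apply: eq_oprod => // t.
    rewrite !scalerA sdeg_cons; congr (_ *: _).
    by rewrite mulrDr ksignD; ring.
  - apply: eq_oprod => // t.
    rewrite !scalerA sdeg_cons; congr (_ *: _).
    rewrite -!ksignD; apply: (@ksign_eq (- (hdeg u * hdeg v))); ring.
  - rewrite (eq_oprod _ _ (fun=> erefl) (fun t => GS [::] t u v)) oprodZr.
    rewrite -oprodZl; apply: eq_oprod => // t.
    rewrite !scalerA; congr (_ *: _).
    by ring.
rewrite !oprod_cons (IHs _ _ (gsym_cons _ FS) GS) scalerDr; congr (_ + _).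
rewrite (IHs _ _ (gsym_twist _ FS) (gsym_cons _ GS)).
by rewrite !scalerA mulrC.
Qed.

Lemma Leibniz_insertion (c : int) p lam F G s :
  (forall t, hdeg (lam t) = sdeg t + c) -> gsymmetric F -> gsymmetric G ->
  insertion lam (oprod mu p F G) s =
    oprod mu p (insertion lam F) G s +
    ksign (p * c) *: oprod mu p (gtwist c F) (insertion lam G) s.
Proof.
elim: s lam c F G => [|u s IHs] lam c F G lamc FS GS.
  rewrite !insertion_nil !oprod_cons !oprod_nil !insertion_nil lamc sdeg_nil.
  by rewrite /gtwist sdeg_nil !mulr0 add0r.
have lamu t : hdeg (lam (u :: t)) = sdeg t + (c + hdeg u).
  by rewrite lamc sdeg_cons; ring.
rewrite (insertion_cons _ _ lamc (oprod_sym _ FS GS)) (IHs _ _ _ _ lamu FS GS).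
have -> : insertion lam (fun t => oprod mu p F G (u :: t)) s =
  insertion lam (oprod mu p (fun t => F (u :: t)) G) s + ksign (p * hdeg u) *:
  insertion lam (oprod mu p (gtwist (hdeg u) F) (fun t => G (u :: t))) s.
  rewrite /insertion scaler_sumr -big_split; apply: eq_bigr => x _ /=.
  by rewrite oprod_cons scalerDr !scalerA (mulrC (ksign _)).
rewrite (IHs _ _ _ _ lamc (gsym_cons _ FS) GS).
rewrite (IHs _ _ _ _ lamc (gsym_twist _ FS) (gsym_cons _ GS)).
rewrite !oprod_cons.
rewrite (eq_oprod (F1 := fun t => insertion lam F (u :: t)) _ _
  (fun t => insertion_cons u t lamc FS) (fun=> erefl)).
rewrite (eq_oprod (G1 := fun t => insertion lam G (u :: t)) _ _ (fun=> erefl)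
  (fun t => insertion_cons u t lamc GS)).
rewrite (eq_oprod (F1 := insertion lam (gtwist (hdeg u) F))
  (F2 := fun t => ksign (c * hdeg u) *:
           (ksign (hdeg u * sdeg t) *: insertion lam F t)) (G2 := fun t => G (u :: t))
   _ _ _ (fun=> erefl)); last first.
  move=> t; rewrite scalerA scaler_sumr; apply: eq_unshuffles => x Dx.
  rewrite /gtwist sdeg_cons lamc addrAC Dx !scalerA; congr (_ *: _).
  by rewrite mulrDr ksignD (mulrC c); ring.
rewrite (eq_oprod (F1 := fun t => gtwist c F (u :: t))
  (F2 := fun t => ksign (c * hdeg u) *: gtwist c (fun t' => F (u :: t')) t)
  (G2 := insertion lam G) _ _ _ (fun=> erefl)); last first.
  by move=> t; rewrite /gtwist sdeg_cons mulrDr ksignD scalerA.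
have eqT t : gtwist (c + hdeg u) F t = ksign (hdeg u * sdeg t) *: gtwist c F t.
  by rewrite /gtwist scalerA mulrDl ksignD mulrC.
have eqT' t : gtwist c (gtwist (hdeg u) F) t =
    ksign (hdeg u * sdeg t) *: gtwist c F t.
  by rewrite /gtwist !scalerA mulrC.
rewrite (eq_oprod _ _ eqT (fun=> erefl)) (eq_oprod _ _ eqT' (fun=> erefl)).
rewrite oprodDl oprodDr !oprodZl !oprodZr.
rewrite !(scalerDr, scalerA) mulrDr ksignD mulN1r -!addrA; congr (_ + _).
rewrite addrC -!addrA; congr (_ + _); rewrite addrCA; congr (_ + _).
  by congr (_ *: _); rewrite mulrAC ksignK mul1r.
congr (_ *: _ + _); first by rewrite mulrC.
rewrite addrC; congr (_ *: _ + _ *: _); first by rewrite mulrN1.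
by ring.
Qed.

Lemma vfield_oprod lam p F G s :
  (forall t, hdeg (lam t) = sdeg t + 1) -> gsymmetric F -> gsymmetric G ->
  vfield lam (oprod mu p F G) s =
    oprod mu (p + 1) (vfield lam F) G s +
    ksign p *: oprod mu p F (vfield lam G) s.
Proof.
move=> lam1 FS GS; rewrite vfieldE (Leibniz_insertion _ _ lam1 FS GS) scalerDr.
congr (_ + _).
  rewrite /oprod scaler_sumr; apply: eq_unshuffles => x Dx.
  rewrite vfieldE muZl !scalerA -Dx; congr (_ *: _).
  rewrite -[RHS]mulrA mulrCA -!ksignD; congr (_ * _).
  by apply: (@ksign_eq 0); ring.
rewrite scalerA mulr1 mulrC -scalerA; congr (_ *: _).
rewrite /oprod scaler_sumr; apply: eq_unshuffles => x Dx.
rewrite vfieldE muZr /gtwist muZl !scalerA -Dx; congr (_ *: _).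
by rewrite mul1r !ksignD ksign1; have := ksignK (sdeg x.2.1) => e1; ring: e1.
Qed.

End Product.

Lemma vfield_linform lam (xi : hvec U -> K^o) n s :
  (forall t, hdeg (lam t) = sdeg t + 1) ->
  (forall u, n + hdeg u != 0 -> xi u = 0) ->
  xi (lam s) = ksign (n + (size s)%:Z) * vfield lam (linform xi) s.
Proof.
move=> lam1 xin; have -> : vfield lam (linform xi) s =
    ksign (sdeg s + 1) *: ((-1) ^+ size s *: xi (lam s)).
  rewrite vfieldE; congr (_ *: _); elim: s lam {lam1} => [|u s IHs] lam.
    by rewrite insertion_nil scale1r.
  rewrite /insertion sum_unshuffles_cons [X in _ + X]big1 ?addr0 /=; last first.
    by move=> x _; rewrite scaler0.
  rewrite exprS -scalerA -(IHs (fun t => lam (u :: t))) scaler_sumr.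
  by apply: eq_bigr => x _ /=; rewrite exprS scalerA mulrCA.
have [n0|/xin ->] := eqVneq (n + hdeg (lam s)) 0; last by rewrite !scaler0 mulr0.
rewrite /GRing.scale /= !mulrA -[LHS]mul1r; congr (_ * _).
rewrite -[(-1) ^+ _]/(ksign (size s)%:Z) -!ksignD -ksign0.
apply/esym/(@ksign_eq (size s)%:Z); rewrite lam1 in n0.
have -> : n = - (sdeg s + 1) by apply/eqP; rewrite -addr_eq0 n0.
by ring.
Qed.

Lemma in_O_cons W (Wdeg : int -> W -> Prop) n f u :
  in_O Wdeg n f -> in_O Wdeg (n + hdeg u) (fun t => f (u :: t)).
Proof.
case=> fM fS fD; split=> [s1|s1|s]; [exact: (fM (u :: s1))|exact: (fS (u :: s1))|].
by rewrite -addrA -sdeg_cons; apply: fD.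
Qed.

Notation odot p x y := (oprod (fun a b : K^o => a * b) p x y).

Lemma in_O_scalar p (x : seq (hvec U) -> K^o) s :
  in_O (@scalar_deg K) p x -> x s = 0 \/ p = - sdeg s.
Proof.
case=> _ _ xD; have [p0|/xD ->] := eqVneq (p + sdeg s) 0; [right|by left].
by apply/eqP; rewrite -subr_eq0 opprK p0.
Qed.

Lemma odot_contraction p q (x y : seq (hvec U) -> K^o) u s :
  in_O (@scalar_deg K) p x -> in_O (@scalar_deg K) q y ->
  odot p x y (u :: s) =
    ksign (hdeg u * q) * odot (p + hdeg u) (fun t => x (u :: t)) y s +
    odot p x (fun t => y (u :: t)) s.
Proof.
move=> xp yq; rewrite oprod_cons; last first.
  by move=> a b c d; rewrite mulrDl -scalerAl.
congr (_ + _).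
  rewrite /oprod big_distrr; apply: eq_bigr => z _ /=.
  have [->|->] := in_O_scalar z.2.2 yq; first by rewrite !mulr0 !scaler0 mulr0.
  rewrite /GRing.scale /= !mulrA; congr (_ * _ * _).
  rewrite mulrC [RHS]mulrAC -ksignD; congr (_ * _).
  by apply: (@ksign_eq 0); ring.
rewrite /oprod scaler_sumr; apply: eq_bigr => z _ /=.
have [->|->] := in_O_scalar z.2.1 xp; first by rewrite scaler0 !mul0r !scaler0.
rewrite /GRing.scale /= !mulrA; congr (_ * _ * _).
rewrite mulrC !mulrA -ksignD -[z.1 in RHS]mul1r -ksign0; congr (_ * _ * _).
by apply: (@ksign_eq 0); ring.
Qed.

Lemma odotC p q (x y : seq (hvec U) -> K^o) s :
  in_O (@scalar_deg K) p x -> in_O (@scalar_deg K) q y ->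
  odot p x y s = ksign (p * q) * odot q y x s.
Proof.
elim: s p q x y => [|u s IHs] p q x y xp yq.
  rewrite !oprod_nil (mulrC (y _)).
  have [->|->] := in_O_scalar [::] yq; first by rewrite !mulr0.
  by rewrite sdeg_nil oppr0 mulr0 ksign0 mul1r.
rewrite (odot_contraction _ _ xp yq) (odot_contraction _ _ yq xp).
rewrite (IHs _ _ _ _ (in_O_cons u xp) yq) (IHs _ _ _ _ xp (in_O_cons u yq)).
rewrite [RHS]mulrDr !mulrA addrC -!ksignD; congr (_ * _ + _ * _).
  by congr ksign; ring.
by apply: (@ksign_eq (hdeg u * q)); ring.
Qed.

Lemma deRham1 (v : hvec U) s :
  deRham (fun t : seq (hvec U) => if t is [::] then 1 : K^o else 0) s v = 0.
Proof. by []. Qed.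

Lemma deRham_linform (xi : hvec U -> K^o) s v :
  deRham (linform xi) s v = if s is [::] then xi v else 0.
Proof. by case: s. Qed.

Lemma deRham_odot p q (x y : seq (hvec U) -> K^o) s v :
  in_O (@scalar_deg K) p x -> in_O (@scalar_deg K) q y ->
  deRham (odot p x y) s v =
    odot p x (fun t => deRham y t v) s +
    ksign (p * q) * odot q y (fun t => deRham x t v) s.
Proof.
move=> xp yq; rewrite /deRham (odot_contraction _ _ xp yq) addrC; congr (_ + _).
rewrite (odotC _ (in_O_cons v xp) yq) mulrA -ksignD; congr (_ * _).
by apply: (@ksign_eq (hdeg v * q)); ring.
Qed.

End VectorFields.

Section SHLiePairs.
Variable K : fieldType.
Local Notation ksign := (ksign K).

(* An L_infty[1]-structure on a graded subspace U of V; bk [:: u_1; ...; u_k] *)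
(* is lambda_k(u_1, ..., u_k), for all k >= 0.                                *)
Record Linf (V : gvect K) (U : {vspace V}) := MkLinf {
  bk :> seq (hvec U) -> hvec U;
  bk_deg : forall s, hdeg (bk s) = sdeg s + 1;
  bk_multi : multilinear (fun s => hval (bk s));
  bk_sym : gsymmetric (fun s => hval (bk s));
  bk_jacobi : forall s,
    \sum_(x <- unshuffles s) x.1 *: hval (bk (bk x.2.1 :: x.2.2)) = 0 }.

Record shpair := SHPair {
  shL :> gvect K;
  shbk : Linf {:shL};
  shA : {vspace shL};
  shA_graded : graded_subspace shA;
  shA_closed : forall s : seq (hvec shA),
    hval (shbk (map (@hincl _ _ _) s)) \in shA }.

Section Pair.
Variable P : shpair.
Local Notation L := (shL P).
Local Notation A := (shA P).
Implicit Types (s : seq (hvec A)) (l : hvec {:L}) (W : lmodType K).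

Definition jseq s : seq (hvec {:L}) := map (@hincl _ _ _) s.

Lemma shbkA_subproof s :
  hval (shbk P (jseq s)) \in (gpart L (hdeg (shbk P (jseq s))) :&: A)%VS.
Proof.
rewrite memv_cap shA_closed andbT.
by have := hvalP (shbk P (jseq s)); rewrite memv_cap => /andP[].
Qed.

Definition shbkA s : hvec A := HVec (shbkA_subproof s).

Definition QL W (f : seq (hvec {:L}) -> W) := vfield (shbk P) f.
Definition QA W (f : seq (hvec A) -> W) := vfield shbkA f.

Definition jdual W (f : seq (hvec {:L}) -> W) s : W := f (jseq s).
Definition Jmap W (f : seq (hvec {:L}) -> W) s l : W := deRham f (jseq s) l.

(* D^perp (x) 1 on A^perp (x) W, then its O(A)-linear extension               *)
(* omega (x) psi |-> (-1)^|omega| omega o. D^perp(psi), with |omega| = - |s1| *)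
(* in the summand indexed by (s1, s2).                                        *)
Definition Dperp W (psi : hvec {:L} -> W) s l : W := Jmap (QL (linform psi)) s l.

Definition Dperp_ext W (X : seq (hvec A) -> hvec {:L} -> W) s l : W :=
  \sum_(x <- unshuffles s)
    (x.1 * ksign (sdeg x.2.1 + sdeg x.2.1 * sdeg x.2.2)) *:
      Dperp (X x.2.1) x.2.2 l.

Section Module.
Variable E : gvect K.

Definition lapp (phi : 'End(E)) (e : E) : E := phi e.
Definition lcomp (phi psi : 'End(E)) : 'End(E) := (phi \o psi)%VF.

(* The operator Q_A + D on O(A) (x) E, for D in (O(A) (x) End(E))^1. *)
Definition dmod (D : seq (hvec A) -> 'End(E)) (f : seq (hvec A) -> E) s : E :=
  QA f s + oprod lapp 1 D f s.

Record amodule := AModule {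
  mop : seq (hvec A) -> 'End(E);
  mop_in : in_O (@end_deg K E) 1 mop;
  mop_flat : forall n f, in_O (@vect_deg K E) n f ->
    forall s, dmod mop (dmod mop f) s = 0 }.

Variable M : amodule.
Local Notation D := (mop M).

(* D^{L,E}, for an L-connection nabla = Q_L + D^{L,E} extending (A, E) *)
Record connection := Connection {
  cop : seq (hvec {:L}) -> 'End(E);
  cop_in : in_O (@end_deg K E) 1 cop;
  cop_ext : forall s, jdual cop s = D s }.

Definition curvature (nabla : connection) (s : seq (hvec {:L})) : 'End(E) :=
  QL (cop nabla) s + oprod lcomp 1 (cop nabla) (cop nabla) s.

Definition atiyah (nabla : connection) : seq (hvec A) -> hvec {:L} -> 'End(E) :=
  Jmap (curvature nabla).

(* Left and right composition with D on O(A) (x) A^perp (x) End(E):           *)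
(*   (eta (x) psi) o (omega (x) xi (x) phi)                                   *)
(*     = (-1)^(|psi|(|omega| + |xi|)) (eta o. omega) (x) xi (x) psi phi,      *)
(*   (omega (x) xi (x) phi) o (eta (x) psi)                                   *)
(*     = (-1)^((|xi| + |phi|)|eta|) (omega o. eta) (x) xi (x) phi psi,        *)
(* for D of degree 1 and X of degree q; besides the signs of oprod, moving    *)
(* psi, of degree 1 + |s1|, past xi, of degree - |l|, contributes.            *)
Definition Dleft (X : seq (hvec A) -> hvec {:L} -> 'End(E)) s l : 'End(E) :=
  \sum_(x <- unshuffles s)
    (x.1 * ksign (sdeg x.2.2 + (1 + sdeg x.2.1) * hdeg l)) *:
      lcomp (D x.2.1) (X x.2.2 l).

Definition Dright (q : int) (X : seq (hvec A) -> hvec {:L} -> 'End(E)) s l :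
    'End(E) :=
  oprod lcomp q (fun t => X t l) D s.

Definition dperpEnd (q : int) (X : seq (hvec A) -> hvec {:L} -> 'End(E)) s l :
    'End(E) :=
  QA X s l + Dperp_ext X s l + (Dleft X s l - ksign q *: Dright q X s l).

End Module.
End Pair.
End SHLiePairs.

Section Cohomology.
Variable K : fieldType.

(* A graded space of cochains, given by the set of cochains of each degree    *)
(* inside an ambient space, with its differential.                            *)
Record cochains := Cochains {
  ccar :> lmodType K;
  cdeg : int -> set ccar;
  cdiff : int -> ccar -> ccar }.

Arguments cdeg : clear implicits.
Arguments cdiff : clear implicits.

Definition cocycle (C : cochains) (n : int) (z : C) : Prop :=
  cdeg C n z /\ cdiff C n z = 0.

Definition cclass (C : cochains) (n : int) (z : C) : set C :=
  [set w | exists2 c, cdeg C (n - 1) c & w = z + cdiff C (n - 1) c].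

Definition cohomology (C : cochains) (n : int) : set (set C) :=
  [set h | exists2 z, cocycle n z & h = cclass n z].

Definition cochains_iso (C C' : cochains) (phi : int -> C -> C') : Prop :=
  forall n, [/\ forall a x y, phi n (a *: x + y) = a *: phi n x + phi n y,
    set_bij (cdeg C n) (cdeg C' n) (phi n) &
    forall x, cdeg C n x -> phi (n + 1) (cdiff C n x) = cdiff C' n (phi n x)].

End Cohomology.

Arguments cdeg {K} C n _ : rename.
Arguments cdiff {K} C n _ : rename.
Arguments cocycle {K} C n z.
Arguments cclass {K} C n z _.
Arguments cohomology {K} C n _.

Section AtiyahClasses.
Variables (K : fieldType) (P : shpair K).
Local Notation L := (shL P).
Local Notation A := (shA P).
Local Notation ksign := (ksign K).

Definition CEperpEnd (E : gvect K) (M : amodule P E) : cochains K :=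
  @Cochains K (seq (hvec A) -> hvec {:L} -> 'End(E))
    (in_O (perp_deg A (@end_deg K E))) (dperpEnd M).

Definition is_atiyah_class (E : gvect K) (M : amodule P E)
    (h : set (CEperpEnd M)) : Prop :=
  cohomology (CEperpEnd M) 2 h /\
  forall nabla : connection M, cclass (CEperpEnd M) 2 (atiyah nabla) = h.

(* L/A, as any graded vector space B with a surjection of degree 0 from L     *)
(* with kernel A.                                                             *)
Record quotient (B : gvect K) := Quotient {
  qproj : 'Hom(L, B);
  qproj_deg : forall d, (qproj @: gpart L d <= gpart B d)%VS;
  qproj_ker : lker qproj = A;
  qproj_surj : limg qproj = fullv }.

Section Quotient.
Variables (B : gvect K) (p : quotient B).

Lemma hproj_subproof (l : hvec {:L}) :
  qproj p (hval l) \in (gpart B (hdeg l) :&: fullv)%VS.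
Proof.
rewrite memv_cap memvf andbT.
apply: (subvP (qproj_deg p (hdeg l))); apply: memv_img.
by have := hvalP l; rewrite memv_cap => /andP[].
Qed.

Definition hproj (l : hvec {:L}) : hvec {:B} := HVec (hproj_subproof l).

(* The A-module structure induced by                                          *)
(*   m_k(a_1, ..., a_(k-1), p(l)) = p(lambda_k(a_1, ..., a_(k-1), l)).        *)
(* As an element of O(A) (x) End(B) it is (-1)^(k-1) m_k: this sign makes it  *)
(* dual to D^perp, see canonical_module_dual.                                 *)
Definition canonical_module (M : amodule P B) : Prop :=
  forall (s : seq (hvec A)) (l : hvec {:L}),
  mop M s (qproj p (hval l)) =
    (-1) ^+ size s *: qproj p (hval (shbk P (rcons (jseq s) l))).

End Quotient.

Section HomBB.
Variables (B : gvect K) (M : amodule P B).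
Local Notation D := (mop M).
Implicit Types (s : seq (hvec A)) (b : hvec {:B}).

Lemma hact_subproof s b :
  D s (hval b) \in (gpart B (hdeg b + (1 + sdeg s)) :&: fullv)%VS.
Proof.
rewrite memv_cap memvf andbT.
apply: (subvP (in_O_deg (mop_in M) s (hdeg b))); apply: memv_img.
by have := hvalP b; rewrite memv_cap => /andP[].
Qed.

Definition hact s b : hvec {:B} := HVec (hact_subproof s b).

(* Y : seq (hvec A) -> hvec {:B} -> 'End(B) stands for the element of         *)
(* O(A) (x) Hom(B (x) B, B) sending b1 (x) b2 to Y s b1 b2.  In degree q its  *)
(* differential is D^B o Y - (-1)^q Y o (D^B (x) 1 + 1 (x) D^B), where        *)
(* (1 (x) psi)(b1 (x) b2) = (-1)^(|psi||b1|) b1 (x) psi(b2), plus Q_A Y.      *)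
Definition dHomBB (q : int) (Y : seq (hvec A) -> hvec {:B} -> 'End(B)) s b :
    'End(B) :=
  QA Y s b + oprod (@lcomp K B) 1 D (fun t => Y t b) s -
  ksign q *: \sum_(x <- unshuffles s) (x.1 * ksign (q * sdeg x.2.2)) *:
    (Y x.2.1 (hact x.2.2 b) +
     ksign ((1 + sdeg x.2.2) * hdeg b) *: lcomp (Y x.2.1 b) (D x.2.2)).

Definition CEHomBB : cochains K :=
  @Cochains K (seq (hvec A) -> hvec {:B} -> 'End(B))
    (in_O (hom_deg (@end_deg K B))) dHomBB.

(* The identification of Hom(B (x) B, B) with A^perp (x) End(B) inverse to    *)
(*   xi (x) phi |-> (b1 (x) b2 |-> (-1)^(|phi||b1|) xi(b1) phi(b2)),          *)
(* where |phi| = n + |s| + |l| for an element of degree n.                    *)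
Definition HomBB_perpEnd (p : quotient B) (n : int)
    (Y : CEHomBB) : CEperpEnd M :=
  fun s l => ksign ((n + sdeg s + hdeg l) * hdeg l) *: Y s (hproj p l).

End HomBB.

Lemma gsymmetric_rcons (V : gvect K) (U : {vspace V}) (W : lmodType K)
    (f : seq (hvec U) -> W) u s : gsymmetric f ->
  f (u :: s) = ksign (hdeg u * sdeg s) *: f (rcons s u).
Proof.
move=> fS; elim: s f fS => [|v s IHs] f fS.
  by rewrite sdeg_nil mulr0 ksign0 scale1r.
rewrite (fS [::]) /= (IHs _ (gsym_cons v fS)) scalerA -ksignD.
by rewrite sdeg_cons mulrDr.
Qed.

(* <D^perp(xi), p(l)> = - (-1)^|xi| <xi, D^B(p(l))>, where on the right       *)
(* <xi, theta (x) b> = (-1)^(|xi||theta|) theta xi(b).                        *)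
Lemma canonical_module_dual (B : gvect K) (p : quotient B) (M : amodule P B)
    (xi : 'Hom(B, K^o)) (n : int) s l :
  canonical_module p M ->
  (forall d, d != - n -> (gpart B d <= lker xi)%VS) ->
  Dperp (fun v => xi (qproj p (hval v))) s l =
    - (ksign n * (ksign (n * sdeg s) * xi (mop M s (qproj p (hval l))))).
Proof.
move=> canM xin; set xi' := fun v => _.
have xi'n v : n + hdeg v != 0 -> xi' v = 0.
  move=> nv; apply/eqP; rewrite -memv_ker.
  have := hvalP (hproj p v); rewrite memv_cap => /andP[Bv _].
  by apply: (subvP (xin _ _)) Bv; rewrite /= -addr_eq0 addrC.
have xi'S : gsymmetric (fun t => xi' (shbk P t)).
  by move=> s1 s2 u v; rewrite /xi' (bk_sym (shbk P)) !linearZ.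
have := vfield_linform (l :: jseq s) (bk_deg (shbk P)) xi'n.
rewrite (gsymmetric_rcons _ _ xi'S) canM linearZ /= -/(xi' _).
have sj : sdeg (jseq s) = sdeg s by rewrite /sdeg big_map.
rewrite size_map sj; move/(congr1 ( *%R (ksign (n + Posz (size s).+1)))).
rewrite mulrA ksignK mul1r.
rewrite -[Dperp _ _ _]/(vfield (shbk P) (linform xi') (l :: jseq s)) => <-.
have [n0|/xi'n ->] := eqVneq (n + hdeg (shbk P (rcons (jseq s) l))) 0; last first.
  by rewrite !scaler0 !mulr0 oppr0.
rewrite /GRing.scale /= !mulrA -mulNr; congr (_ * _).
rewrite -[(-1) ^+ _]/(ksign (size s)%:Z) -!ksignD -mulN1r -ksign1 -ksignD.
move: n0; rewrite bk_deg -cats1 sdeg_cat sdeg_cons sdeg_nil addr0 sj => n0.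
have -> : hdeg l = - (n + sdeg s + 1).
  by apply/eqP; rewrite -addr_eq0; apply/eqP; rewrite -n0; ring.
rewrite -[LHS]mulr1 -(ksignMS K (sdeg s)) -ksignD intS.
by apply: (@ksign_eq K (- (n * sdeg s))); ring.
Qed.

End AtiyahClasses.

(* Main.v *)
From HB Require Import structures.
Require Import Defs.
From mathcomp Require Import all_boot all_order all_algebra.
From mathcomp Require Import boolp classical_sets functions.
From mathcomp Require Import ring.

Set Implicit Arguments.
Unset Strict Implicit.
Unset Printing Implicit Defensive.

Import GRing.Theory.
Local Open Scope ring_scope.

(** On arguments that all lie in [A], the curvature [R = Q(D) + D D] of a
    connection is the square of the module differential, hence zero. It also
    satisfies the Bianchi identity [Q(R) + D R - R D = 0]. Evaluate this
    identity on one argument [l] in [L] and the others in [A]. As [R] vanishes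
    on [A], only the terms survive in which [R] receives [l], possibly inside a
    bracket, and they are exactly the differential of [J(R)]: the bracket of [l]
    with arguments in [A] is the action on [L / A], dually on the annihilator of
    [A]. Hence [J] turns the commutator with the connection into the
    differential, on the cochains of [L] that vanish on [A] ([J_QL], [J_left],
    [J_right]).

    This gives both halves of the theorem for a module [E]. Applied to the
    Bianchi identity ([Bianchi]) it shows that the Atiyah cochain is a cocycle
    ([atiyah_cocycle]). Two connections differ by a cochain [delta] vanishing on
    [A], and their curvatures by [Q(delta) + D' delta + delta D], so that their
    Atiyah cocycles differ by the coboundary of [J(delta)]
    ([atiyah_difference]). The class also has to be pinned down by at least one
    connection: composing the module operator with a graded projection of [L]
    onto [A] gives one ([projection_connection]).

    For the quotient [B = L / A], the bracket with one argument in [L] and the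
    others in [A] descends to [B], and the Jacobi identity says that this action
    is flat ([canonical_flat]). The comparison between [Hom (B (x) B, B)] and
    [A^perp (x) End B] is bijective because every homogeneous vector of [B]
    lifts to a homogeneous vector of [L] ([hproj_onto]), and it commutes with
    the differentials term by term ([HomBB_perpEnd_diff]).

    All the sign computations go through sums over unshuffles, which are
    coassociative and cocommutative up to Koszul signs ([conv_assoc],
    [conv_swap]); the remaining identities between signs depend only on
    parities and are checked by cases ([sign_cases]). *)

(** * Signs *)

Definition oddz (n : int) : bool := odd `|n|%N.

Lemma ksign_oddz (K : fieldType) n : ksign K n = if oddz n then -1 else 1.
Proof.
rewrite /ksign /oddz; case: n => n.
  by rewrite -exprnP /= -signr_odd; case: (odd n).
by rewrite NegzE abszN -exprnN -exprVn invrN1 -signr_odd; case: (odd _).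
Qed.

Lemma oddzD m n : oddz (m + n) = oddz m (+) oddz n.
Proof.
have := ksignD rat m n; rewrite !ksign_oddz.
by do 3!case: (oddz _).
Qed.

Lemma oddzN n : oddz (- n) = oddz n.
Proof. by rewrite /oddz abszN. Qed.

Lemma oddzM m n : oddz (m * n) = oddz m && oddz n.
Proof. by rewrite /oddz abszM oddM. Qed.

Lemma oddzS n : oddz (n.+1)%:Z = ~~ oddz n%:Z.
Proof. by []. Qed.

Lemma oddz0 : oddz 0 = false. Proof. by []. Qed.
Lemma oddz1 : oddz 1 = true. Proof. by []. Qed.

Definition oddzE :=
  (PoszD, oddzD, oddzN, oddzM, oddzS, oddz0, oddz1).

Lemma exprN1_ksign (K : fieldType) n : (-1) ^+ n = ksign K n%:Z.
Proof. by []. Qed.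

(** An identity between products of signs depends only on the parities of the
    degrees involved. *)
Ltac sign_cases :=
  rewrite ?exprN1_ksign ?ksign_oddz ?oddzE;
  repeat match goal with |- context [oddz ?x] => case: (oddz x) end;
  rewrite /=; ring.

Section UnshuffleSums.
Variables (K : fieldType) (V : gvect K) (U : {vspace V}).
Implicit Types (s a b c : seq (hvec U)) (u v w : hvec U) (W : lmodType K).
Local Notation ksign := (ksign K).

(** * Functions linear on homogeneous vectors *)

Lemma hvec_eq u v : hdeg u = hdeg v -> hval u = hval v -> u = v.
Proof.
case: u v => [d x xP] [e y yP] /= de xy; subst.
by congr HVec; apply: eq_irrelevance.
Qed.

Lemma hzero_subproof d : (0 : V) \in (gpart V d :&: U)%VS.
Proof. exact: mem0v. Qed.

Definition hzero d : hvec U := HVec (hzero_subproof d).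

Lemma hlin_subproof (k : K) u v :
  k *: hval u + (if hdeg v == hdeg u then hval v else 0) \in
    (gpart V (hdeg u) :&: U)%VS.
Proof.
apply: memvD; first by apply: memvZ; apply: hvalP.
by case: eqP => [<-|_]; [apply: hvalP | apply: mem0v].
Qed.

(** Totalized: for [v] of another degree than [u], the sum [k u + v] would not
    be homogeneous. *)
Definition hlin (k : K) u v : hvec U := HVec (hlin_subproof k u v).

Lemma hlinE (k : K) u v : hdeg v = hdeg u ->
  hval (hlin k u v) = k *: hval u + hval v.
Proof. by move=> vu; rewrite /= vu eqxx. Qed.

Lemma hlinear0 W (psi : hvec U -> W) u : hlinear psi -> hval u = 0 -> psi u = 0.
Proof.
move=> psiL u0; have := psiL 1 u u u erefl erefl.
rewrite u0 scaler0 addr0 scale1r => /(_ erefl)/eqP.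
by rewrite eq_sym -subr_eq0 addrK => /eqP.
Qed.

Lemma hlinearZ W (psi : hvec U -> W) (k : K) u w : hlinear psi ->
  hdeg u = hdeg w -> hval w = k *: hval u -> psi w = k *: psi u.
Proof.
move=> psiL uw wE.
rewrite (psiL k u (hzero (hdeg w)) w) //= ?wE ?addr0 //.
by rewrite (hlinear0 (u := hzero _) psiL erefl) addr0.
Qed.

Lemma eq_hlinear W (psi phi : hvec U -> W) :
  psi =1 phi -> hlinear psi -> hlinear phi.
Proof. by move=> /funext ->. Qed.

Lemma hlinearD W (psi phi : hvec U -> W) :
  hlinear psi -> hlinear phi -> hlinear (fun u => psi u + phi u).
Proof.
move=> psiL phiL k u v w uw vw wE.
by rewrite (psiL k u v) // (phiL k u v) // scalerDr addrACA.
Qed.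

Lemma hlinear_scale W (psi : hvec U -> W) (k : int -> K) :
  hlinear psi -> hlinear (fun u => k (hdeg u) *: psi u).
Proof.
move=> psiL x u v w uw vw wE.
by rewrite uw vw (psiL x u v) // scalerDr !scalerA (mulrC x).
Qed.

(** * Sums over unshuffles *)

(** The convolution along the unshuffle coproduct. Products, brackets inserted
    into a cochain and differentials all have this form, so that their
    multilinearity, symmetry and compositions reduce to properties of [conv]. *)
Definition conv W (Phi : seq (hvec U) -> seq (hvec U) -> W) s : W :=
  \sum_(x <- unshuffles s) x.1 *: Phi x.2.1 x.2.2.

Lemma conv_nil W (Phi : seq (hvec U) -> seq (hvec U) -> W) :
  conv Phi [::] = Phi [::] [::].
Proof. by rewrite /conv sum_unshuffles_nil scale1r. Qed.

Lemma conv_cons W (Phi : seq (hvec U) -> seq (hvec U) -> W) u s :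
  conv Phi (u :: s) = conv (fun a b => Phi (u :: a) b) s +
    conv (fun a b => ksign (hdeg u * sdeg a) *: Phi a (u :: b)) s.
Proof.
rewrite /conv sum_unshuffles_cons; congr (_ + _).
by apply: eq_bigr => x _; rewrite scalerA.
Qed.

Lemma eq_conv W (Phi Psi : seq (hvec U) -> seq (hvec U) -> W) s :
  (forall a b, sdeg a + sdeg b = sdeg s -> (size a + size b)%N = size s ->
     Phi a b = Psi a b) ->
  conv Phi s = conv Psi s.
Proof.
elim: s Phi Psi => [|u s IHs] Phi Psi eqP.
  by rewrite !conv_nil eqP //= sdeg_nil addr0.
rewrite !conv_cons; congr (_ + _); apply: IHs => a b dab sab.
  by rewrite eqP //= ?sdeg_cons -?dab -?sab ?addrA.
by congr (_ *: _); rewrite eqP //= ?sdeg_cons -?dab -?sab ?addnS // addrCA.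
Qed.

Lemma convD W (Phi Psi : seq (hvec U) -> seq (hvec U) -> W) s :
  conv (fun a b => Phi a b + Psi a b) s = conv Phi s + conv Psi s.
Proof.
by rewrite /conv -big_split; apply: eq_bigr => x _; rewrite scalerDr.
Qed.

Lemma convZ W (Phi : seq (hvec U) -> seq (hvec U) -> W) (k : K) s :
  conv (fun a b => k *: Phi a b) s = k *: conv Phi s.
Proof.
rewrite /conv scaler_sumr; apply: eq_bigr => x _.
by rewrite !scalerA mulrC.
Qed.

Lemma conv0 W (Phi : seq (hvec U) -> seq (hvec U) -> W) s :
  (forall a b, Phi a b = 0) -> conv Phi s = 0.
Proof. by move=> Phi0; apply: big1 => x _; rewrite Phi0 scaler0. Qed.

Lemma conv_unit (W : lmodType K) (g : seq (hvec U) -> W) s :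
  conv (fun a b => if b is [::] then g a else 0) s = g s.
Proof.
elim: s g => [|u s IHs] g; first by rewrite conv_nil.
rewrite conv_cons [X in _ + X]conv0 ?addr0 ?(IHs (fun t => g (u :: t))) //.
by move=> a b; rewrite scaler0.
Qed.

Lemma conv_linear (W W' : lmodType K) (g : W -> W')
    (Phi : seq (hvec U) -> seq (hvec U) -> W) s :
  (forall k x y, g (k *: x + y) = k *: g x + g y) ->
  g (conv Phi s) = conv (fun a b => g (Phi a b)) s.
Proof.
move=> gL; have g0 : g 0 = 0.
  have := gL 1 0 0; rewrite !scale1r addr0 => /eqP.
  by rewrite eq_sym -subr_eq0 addrK => /eqP.
rewrite /conv; elim: (unshuffles s) => [|x r IHr]; first by rewrite !big_nil.
by rewrite !big_cons gL IHr.
Qed.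

(** Graded cocommutativity of the unshuffle coproduct. *)
Lemma conv_swap W (Phi : seq (hvec U) -> seq (hvec U) -> W) s :
  conv Phi s = conv (fun a b => ksign (sdeg a * sdeg b) *: Phi b a) s.
Proof.
elim: s Phi => [|u s IHs] Phi.
  by rewrite !conv_nil sdeg_nil mulr0 scale1r.
rewrite !conv_cons addrC IHs; congr (_ + _); last rewrite IHs;
  apply: eq_conv => a b _ _; rewrite !scalerA sdeg_cons; congr (_ *: _);
  sign_cases.
Qed.

(** Coassociativity of the unshuffle coproduct: both sides run over the
    unshuffles into three blocks, and the Koszul signs agree because degrees
    add up along blocks. *)
Lemma conv_assoc W
    (Phi : seq (hvec U) -> seq (hvec U) -> seq (hvec U) -> W) s :
  conv (fun a t => conv (Phi a) t) s =
  conv (fun t c => conv (fun a b => Phi a b c) t) s.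
Proof.
elim: s Phi => [|u s IHs] Phi; first by rewrite !conv_nil.
rewrite !conv_cons IHs.
have -> : conv (fun a t => ksign (hdeg u * sdeg a) *: conv (Phi a) (u :: t)) s =
  conv (fun a t => conv (fun b c =>
     ksign (hdeg u * sdeg a) *: Phi a (u :: b) c) t) s +
  conv (fun a t => conv (fun b c =>
     ksign (hdeg u * (sdeg a + sdeg b)) *: Phi a b (u :: c)) t) s.
  rewrite -convD; apply: eq_conv => a t _ _.
  rewrite conv_cons scalerDr -!convZ; congr (_ + _); apply: eq_conv => b c _ _.
  by rewrite scalerA mulrDr ksignD.
rewrite !IHs addrA; congr (_ + _).
  by rewrite -convD; apply: eq_conv => t c _ _; rewrite conv_cons.
apply: eq_conv => t c _ _; rewrite -convZ; apply: eq_conv => a b dab _.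
by rewrite dab.
Qed.

Lemma hlinear_conv W (Phi : hvec U -> seq (hvec U) -> seq (hvec U) -> W) s :
  (forall a b, hlinear (fun u => Phi u a b)) ->
  hlinear (fun u => conv (Phi u) s).
Proof.
move=> PhiL k u v w uw vw wE; rewrite -convZ -convD.
by apply: eq_conv => a b _ _; apply: PhiL.
Qed.

Lemma conv_multi W (Phi : seq (hvec U) -> seq (hvec U) -> W) :
  (forall b, multilinear (fun a => Phi a b)) -> (forall a, multilinear (Phi a)) ->
  multilinear (conv Phi).
Proof.
move=> Phil Phir s1; elim: s1 Phi Phil Phir => [|v s1 IH] Phi Phil Phir s2 /=.
  apply: (eq_hlinear (fun u => esym (conv_cons Phi u s2))).
  apply: hlinearD; apply: hlinear_conv => a b; first exact: (Phil b [::]).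
  apply: (@hlinear_scale _ _ (fun d => ksign (d * sdeg a))).
  exact: (Phir a [::]).
apply: (eq_hlinear (fun u => esym (conv_cons Phi v (s1 ++ u :: s2)))).
apply: hlinearD; apply: IH => [b|a].
- by move=> t1; apply: (Phil b (v :: t1)).
- by move=> t1; apply: (Phir (v :: a) t1).
- move=> t1 t2 k u v' w uw vw wE.
  rewrite (Phil _ _ _ k u v') // !sdeg_cat !sdeg_cons uw vw.
  by rewrite scalerDr !scalerA (mulrC k).
move=> t1; have := Phir a (v :: t1) => /= PL t2 k u v' w uw vw wE.
by rewrite (PL _ k u v') // scalerDr !scalerA (mulrC k).
Qed.

Lemma conv_sym W (Phi : seq (hvec U) -> seq (hvec U) -> W) :
  (forall b, gsymmetric (fun a => Phi a b)) -> (forall a, gsymmetric (Phi a)) ->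
  gsymmetric (conv Phi).
Proof.
move=> Phil Phir s1; elim: s1 Phi Phil Phir => [|w s1 IH] Phi Phil Phir s2 u v /=.
  rewrite !conv_cons -!convD -convZ; apply: eq_conv => a b _ _.
  rewrite (Phil _ [::]) (Phir _ [::]) /= !scalerDr !scalerA !sdeg_cons.
  rewrite -!addrA; congr (_ + _); rewrite addrCA.
  by congr (_ *: _ + (_ *: _ + _ *: _)); sign_cases.
rewrite !conv_cons scalerDr; congr (_ + _); apply: IH => [b|a].
- by move=> t1; apply: (Phil b (w :: t1)).
- by move=> t1; apply: (Phir (w :: a) t1).
- move=> t1 t2 u' v'; rewrite Phil !sdeg_cat !sdeg_cons !scalerA.
  by congr (_ *: _); rewrite mulrC (addrCA (hdeg u')).
move=> t1 t2 u' v'; have /= -> := Phir a (w :: t1) t2 u' v'.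
by rewrite !scalerA mulrC.
Qed.

Lemma conv_ind W (Q : W -> Prop) (Phi : seq (hvec U) -> seq (hvec U) -> W) s :
  (forall (k : K) x y, Q x -> Q y -> Q (k *: x + y)) ->
  (forall a b, sdeg a + sdeg b = sdeg s -> Q (Phi a b)) -> Q (conv Phi s).
Proof.
move=> Qlin; have Q0 x : Q x -> Q 0.
  by move=> Qx; have := Qlin (-1) _ _ Qx Qx; rewrite scaleN1r addNr.
elim: s Phi => [|u s IHs] Phi QPhi.
  by rewrite conv_nil; apply: QPhi; rewrite sdeg_nil addr0.
rewrite conv_cons -[X in X + _]scale1r; apply: (Qlin); apply: IHs => a b dab.
  by apply: QPhi; rewrite !sdeg_cons -addrA dab.
have := QPhi a (u :: b); rewrite !sdeg_cons addrCA dab => /(_ erefl) QPab.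
by rewrite -[_ *: _]addr0; apply: Qlin => //; apply: Q0 QPab.
Qed.

(** This serves to insert the Jacobi identity, an equation between vectors,
    into an argument of a cochain. *)
Lemma hlinear_sum W (psi : hvec U -> W)
    (g : seq (hvec U) -> seq (hvec U) -> hvec U) s w :
  hlinear psi ->
  (forall a b, sdeg a + sdeg b = sdeg s -> hdeg (g a b) = hdeg w) ->
  hval w = conv (fun a b => hval (g a b)) s ->
  psi w = conv (fun a b => psi (g a b)) s.
Proof.
move=> psiL gw.
(* The induction below runs over an arbitrary list, in which the entries of
   the wrong degree have to be replaced by zero. *)
pose g' a b := if hdeg (g a b) == hdeg w then g a b else hzero (hdeg w).
have gE a b : sdeg a + sdeg b = sdeg s -> g a b = g' a b.
  by move=> dab; rewrite /g' gw // eqxx.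
rewrite (eq_conv (Psi := fun a b => hval (g' a b))); last by move=> a b /gE ->.
rewrite (eq_conv (Psi := fun a b => psi (g' a b)) (s := s)); last first.
  by move=> a b /gE ->.
have g'w a b : hdeg (g' a b) = hdeg w by rewrite /g'; case: eqP.
move: g' g'w {gw gE} => g' g'w; set d := hdeg w in g'w *.
have : hdeg w = d by [].
rewrite /conv; elim: (unshuffles s) w @d g'w => [|x r IHr] w d g'w.
  by move=> _; rewrite !big_nil; apply: hlinear0.
rewrite !big_cons => wd wE.
have tP : \sum_(y <- r) y.1 *: hval (g' y.2.1 y.2.2) \in (gpart V d :&: U)%VS.
  apply: memv_suml => y _; apply: memvZ.
  by have := hvalP (g' y.2.1 y.2.2); rewrite g'w.
by rewrite (psiL x.1 (g' x.2.1 x.2.2) (HVec tP)) ?g'w //= (IHr (HVec tP)).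
Qed.

(** * Multilinearity and symmetry of cochains *)

Lemma multi_twist W (k : int -> nat -> K) (f : seq (hvec U) -> W) :
  multilinear f -> multilinear (fun s => k (sdeg s) (size s) *: f s).
Proof.
move=> fM s1 s2 x u v w uw vw wE.
rewrite (fM s1 s2 x u v w) // !sdeg_cat !sdeg_cons uw vw !size_cat /=.
by rewrite scalerDr !scalerA (mulrC x).
Qed.

Lemma sym_twist W (k : int -> nat -> K) (f : seq (hvec U) -> W) :
  gsymmetric f -> gsymmetric (fun s => k (sdeg s) (size s) *: f s).
Proof.
move=> fS s1 s2 u v; rewrite fS !sdeg_cat !sdeg_cons !size_cat /=.
by rewrite (addrCA (hdeg u)) !scalerA mulrC.
Qed.

Lemma multi_cons W (f : seq (hvec U) -> W) u :
  multilinear f -> multilinear (fun t => f (u :: t)).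
Proof. by move=> fM s1 s2; apply: (fM (u :: s1) s2). Qed.

Section Products.
Variables (W1 W2 W3 : lmodType K) (mu : W1 -> W2 -> W3).
Hypothesis muDl : forall k x y z, mu (k *: x + y) z = k *: mu x z + mu y z.
Hypothesis muDr : forall k x y z, mu z (k *: x + y) = k *: mu z x + mu z y.
Implicit Types (F : seq (hvec U) -> W1) (G : seq (hvec U) -> W2).

Lemma oprod_conv p F G s : oprod mu p F G s =
  conv (fun a b => ksign (p * sdeg b) *: mu (F a) (G b)) s.
Proof. by apply: eq_bigr => x _; rewrite scalerA. Qed.

Lemma oprod_multi p F G :
  multilinear F -> multilinear G -> multilinear (oprod mu p F G).
Proof.
move=> FM GM; have -> := funext (oprod_conv p F G).
apply: conv_multi => [b|a].
  move=> s1 s2 k u v w uw vw wE.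
  by rewrite (FM s1 s2 k u v) // muDl scalerDr !scalerA (mulrC k).
apply: (@multi_twist _ (fun d _ => ksign (p * d))).
by move=> s1 s2 k u v w uw vw wE; rewrite (GM s1 s2 k u v) // muDr.
Qed.

Lemma oprod_0l p F G s : (forall t, F t = 0) -> oprod mu p F G s = 0.
Proof.
by move=> F0; rewrite oprod_conv; apply: conv0 => a b;
  rewrite F0 (mu0l muDl) scaler0.
Qed.

Lemma oprod_0r p F G s : (forall t, G t = 0) -> oprod mu p F G s = 0.
Proof.
by move=> G0; rewrite oprod_conv; apply: conv0 => a b;
  rewrite G0 (mu0r muDr) scaler0.
Qed.

End Products.

Lemma oprodD_l (W1 W2 W3 : lmodType K) (mu : W1 -> W2 -> W3) p
    (F F' : seq (hvec U) -> W1) (G : seq (hvec U) -> W2) s :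
  (forall k x y z, mu (k *: x + y) z = k *: mu x z + mu y z) ->
  oprod mu p (fun t => F t + F' t) G s = oprod mu p F G s + oprod mu p F' G s.
Proof.
move=> muDl; rewrite -[oprod mu p F G s]scale1r -(oprodDl muDl).
by apply: eq_oprod => // t; rewrite scale1r.
Qed.

Lemma oprodD_r (W1 W2 W3 : lmodType K) (mu : W1 -> W2 -> W3) p
    (F : seq (hvec U) -> W1) (G G' : seq (hvec U) -> W2) s :
  (forall k x y z, mu z (k *: x + y) = k *: mu z x + mu z y) ->
  oprod mu p F (fun t => G t + G' t) s = oprod mu p F G s + oprod mu p F G' s.
Proof.
move=> muDr; rewrite -[oprod mu p F G s]scale1r -(oprodDr muDr).
by apply: eq_oprod => // t; rewrite scale1r.
Qed.

Lemma oprod_assoc (W1 W2 W3 W12 W23 W123 : lmodType K)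
    (mu12 : W1 -> W2 -> W12) (mu123 : W12 -> W3 -> W123)
    (mu23 : W2 -> W3 -> W23) (mu123' : W1 -> W23 -> W123) p q
    (F : seq (hvec U) -> W1) (G : seq (hvec U) -> W2) (H : seq (hvec U) -> W3) s :
  (forall k x y z, mu123 (k *: x + y) z = k *: mu123 x z + mu123 y z) ->
  (forall k x y z, mu123' z (k *: x + y) = k *: mu123' z x + mu123' z y) ->
  (forall x y z, mu123' x (mu23 y z) = mu123 (mu12 x y) z) ->
  oprod mu123' p F (oprod mu23 q G H) s =
    oprod mu123 (p + q) (oprod mu12 p F G) H s.
Proof.
move=> muDl muDr muA; rewrite !oprod_conv.
pose Phi a b c := ksign (p * (sdeg b + sdeg c) + q * sdeg c) *:
  mu123' (F a) (mu23 (G b) (H c)).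
transitivity (conv (fun a t => conv (Phi a) t) s).
  apply: eq_conv => a t _ _; rewrite oprod_conv conv_linear; last first.
    by move=> k x y; apply: muDr.
  rewrite -convZ; apply: eq_conv => b c dt _.
  by rewrite /Phi (muZr muDr) scalerA -dt ksignD.
rewrite conv_assoc; apply: eq_conv => t c _ _; rewrite oprod_conv.
rewrite (conv_linear (g := mu123^~ (H c))); last by move=> k x y; apply: muDl.
rewrite -convZ; apply: eq_conv => a b _ _.
rewrite (muZl muDl) scalerA /Phi muA; congr (_ *: _).
by sign_cases.
Qed.

(** * Vector fields *)

Lemma insertion_conv lam W (f : seq (hvec U) -> W) s :
  insertion lam f s = conv (fun a b => (-1) ^+ size a *: f (lam a :: b)) s.
Proof. by apply: eq_bigr => x _; rewrite scalerA. Qed.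

Lemma vfield_conv lam W (f : seq (hvec U) -> W) s : vfield lam f s =
  ksign (sdeg s + 1) *: conv (fun a b => (-1) ^+ size a *: f (lam a :: b)) s.
Proof. by rewrite vfieldE insertion_conv. Qed.

Lemma vfieldD lam W (f g : seq (hvec U) -> W) s :
  vfield lam (fun t => f t + g t) s = vfield lam f s + vfield lam g s.
Proof.
rewrite !vfield_conv -scalerDr -convD; congr (_ *: _).
by apply: eq_conv => a b _ _; rewrite scalerDr.
Qed.

Lemma vfieldZ lam W (f : seq (hvec U) -> W) k s :
  vfield lam (fun t => k *: f t) s = k *: vfield lam f s.
Proof.
rewrite !vfield_conv scalerA mulrC -scalerA -[in RHS]convZ; congr (_ *: _).
by apply: eq_conv => a b _ _; rewrite !scalerA mulrC.
Qed.

Lemma vfield_app lam (T : Type) W (f : seq (hvec U) -> T -> W) s (x : T) :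
  vfield lam f s x = vfield lam (fun t => f t x) s.
Proof.
rewrite !vfield_conv -[LHS]/(_ *: (conv _ s x)); congr (_ *: _).
by rewrite (conv_linear (g := fun h : T -> W => h x)).
Qed.

Lemma vfield_linformE lam (W : lmodType K) (psi : hvec U -> W) s :
  vfield lam (linform psi) s =
    (ksign (sdeg s + 1) * (-1) ^+ size s) *: psi (lam s).
Proof.
rewrite vfield_conv -scalerA; congr (_ *: _).
elim: s lam => [|u s IHs] lam; first by rewrite conv_nil.
rewrite conv_cons [X in _ + X]conv0 ?addr0; last first.
  by move=> a b; rewrite !scaler0.
rewrite exprS -scalerA -(IHs (fun t => lam (u :: t))) -convZ.
by apply: eq_conv => a b _ _; rewrite scalerA -exprS.
Qed.

Section Brackets.
Variable lam : Linf U.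

Lemma head_multi W (f : seq (hvec U) -> W) b :
  multilinear f -> multilinear (fun a => f (lam a :: b)).
Proof.
move=> fM s1 s2 k u v w uw vw wE; apply: (fM [::] b).
- by rewrite !bk_deg !sdeg_cat !sdeg_cons uw.
- by rewrite !bk_deg !sdeg_cat !sdeg_cons vw.
exact: (bk_multi lam).
Qed.

Lemma head_sym W (f : seq (hvec U) -> W) b :
  multilinear f -> gsymmetric (fun a => f (lam a :: b)).
Proof.
move=> fM s1 s2 u v; apply: (hlinearZ (fM [::] b)).
  by rewrite !bk_deg !sdeg_cat !sdeg_cons (addrCA (hdeg u)).
exact: (bk_sym lam).
Qed.

Lemma vfield_multi W (f : seq (hvec U) -> W) :
  multilinear f -> multilinear (vfield lam f).
Proof.
move=> fM; have -> := funext (vfield_conv lam f).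
apply: (@multi_twist _ (fun d _ => ksign (d + 1))); apply: conv_multi => [b|a].
  apply: (@multi_twist _ (fun _ n => (-1) ^+ n)); exact: head_multi.
apply: (@multi_twist _ (fun _ _ => (-1) ^+ size a)); exact: multi_cons.
Qed.

Lemma vfield_sym W (f : seq (hvec U) -> W) :
  multilinear f -> gsymmetric f -> gsymmetric (vfield lam f).
Proof.
move=> fM fS; have -> := funext (vfield_conv lam f).
apply: (@sym_twist _ (fun d _ => ksign (d + 1))); apply: conv_sym => [b|a].
  apply: (@sym_twist _ (fun _ n => (-1) ^+ n)); exact: head_sym.
apply: (@sym_twist _ (fun _ _ => (-1) ^+ size a)); exact: gsym_cons.
Qed.

(** The two kinds of terms of [Q (Q f)] vanish separately. Those in which one
    bracket is nested in the other add up, after unshuffling into three blocks,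
    to the Jacobi identity inserted into [f]. Those with two separate brackets
    change sign when the two blocks are exchanged, as the brackets are of odd
    degree; here the characteristic must not be two. *)
Lemma vfield_square W (f : seq (hvec U) -> W) s :
  [pchar K] =i pred0 -> multilinear f -> gsymmetric f ->
  vfield lam (vfield lam f) s = 0.
Proof.
move=> charK0 fM fS.
pose nested a b c := (-1) ^+ (size a + size b) *: f (lam (lam a :: b) :: c).
pose separate a b c := (ksign (sdeg a + 1) * (-1) ^+ (size a + size b)) *:
  f (lam a :: lam b :: c).
have nested0 : conv (fun a t => conv (nested a) t) s = 0.
  rewrite conv_assoc; apply: conv0 => t c.
  transitivity ((-1) ^+ size t *: conv (fun a b => f (lam (lam a :: b) :: c)) t).
    by rewrite -convZ; apply: eq_conv => a b _ <-.
  rewrite -(@hlinear_sum _ (fun u => f (u :: c)) _ t (hzero (sdeg t + 1 + 1))).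
  - by rewrite (hlinear0 (u := hzero _) (fM [::] c)) // scaler0.
  - exact: (fM [::] c).
  - by move=> a b dt; rewrite !bk_deg sdeg_cons bk_deg -dt /=; ring.
  by have /esym := bk_jacobi lam t.
have separate0 : conv (fun a t => conv (separate a) t) s = 0.
  rewrite conv_assoc; apply: conv0 => t c; set X := conv _ _.
  suff XN : X = - X.
    have := congr1 (+%R^~ X) XN; rewrite addNr -mulr2n -scaler_nat => /eqP.
    rewrite scaler_eq0 => /orP[|/eqP//].
    by have := charK0 2; rewrite !inE /= => ->.
  rewrite {1}/X conv_swap -scaleN1r /X -convZ; apply: eq_conv => a b _ _.
  rewrite /separate (fS [::]) /= !scalerA !bk_deg; congr (_ *: _).
  by sign_cases.
rewrite vfield_conv.
transitivity (ksign (sdeg s + 1) *: (ksign (sdeg s) *: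
    (conv (fun a t => conv (separate a) t) s -
     conv (fun a t => conv (nested a) t) s))); last first.
  by rewrite nested0 separate0 subr0 !scaler0.
congr (_ *: _); rewrite -scaleN1r -convZ -convD -convZ.
apply: eq_conv => a t <- _.
rewrite vfieldE (insertion_cons _ _ (bk_deg lam) fS) !insertion_conv.
rewrite !scalerDr !scalerA -!convZ -!convD; apply: eq_conv => b c _ _.
rewrite /separate /nested !scalerA addrC sdeg_cons bk_deg.
congr (_ *: _ + _ *: _); sign_cases.
Qed.

End Brackets.

End UnshuffleSums.

(** * Curvature *)

Section Curvature.
Variables (K : fieldType) (V : gvect K) (U : {vspace V}).
Local Notation ksign := (ksign K).

Variable E : gvect K.

Lemma lcompDl k (x y z : 'End(E)) :
  lcomp (k *: x + y) z = k *: lcomp x z + lcomp y z.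
Proof. by rewrite /lcomp comp_lfunDl comp_lfunZl. Qed.

Lemma lcompDr k (x y z : 'End(E)) :
  lcomp z (k *: x + y) = k *: lcomp z x + lcomp z y.
Proof. by rewrite /lcomp comp_lfunDr comp_lfunZr. Qed.

Lemma lappDl k (x y : 'End(E)) z :
  lapp (k *: x + y) z = k *: lapp x z + lapp y z.
Proof. by rewrite /lapp add_lfunE scale_lfunE. Qed.

Lemma lappDr k (x y : E) (z : 'End(E)) :
  lapp z (k *: x + y) = k *: lapp z x + lapp z y.
Proof. by rewrite /lapp linearP. Qed.

Definition curv (lam : seq (hvec U) -> hvec U) (D : seq (hvec U) -> 'End(E)) s :
    'End(E) :=
  vfield lam D s + oprod (@lcomp K E) 1 D D s.

Lemma end_deg_lin k (c : K) (phi psi : 'End(E)) :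
  end_deg k phi -> end_deg k psi -> end_deg k (c *: phi + psi).
Proof.
move=> phik psik d; apply/subvP => _ /memv_imgP[v vd ->].
rewrite add_lfunE scale_lfunE; apply: memvD.
  by apply/memvZ/(subvP (phik d))/memv_img.
exact/(subvP (psik d))/memv_img.
Qed.

Lemma end_degZ k (c : K) (phi : 'End(E)) :
  end_deg k phi -> end_deg k (c *: phi).
Proof.
move=> phik d; apply/subvP => _ /memv_imgP[v vd ->]; rewrite scale_lfunE.
by apply/memvZ/(subvP (phik d))/memv_img.
Qed.

Lemma end_deg_comp k m (phi psi : 'End(E)) :
  end_deg k phi -> end_deg m psi -> end_deg (k + m) (lcomp phi psi).
Proof.
move=> phik psim d; apply/subvP => _ /memv_imgP[v vd ->].
rewrite /lcomp comp_lfunE addrCA addrC.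
by apply: (subvP (phik _)); apply: memv_img; apply: (subvP (psim _)); apply: memv_img.
Qed.

Variable lam : Linf U.
Variable D : seq (hvec U) -> 'End(E).
Hypothesis D_in : in_O (@end_deg K E) 1 D.
Hypothesis charK0 : [pchar K] =i pred0.

Let DM := in_O_multi D_in.
Let DS := in_O_sym D_in.

Lemma curv_in : in_O (@end_deg K E) 2 (curv lam D).
Proof.
have vM := vfield_multi lam DM; have vS := vfield_sym lam DM DS.
have oM := oprod_multi lcompDl lcompDr 1 DM DM.
have oS := oprod_sym lcompDl lcompDr 1 DS DS.
split=> [s1 s2|s1 s2 u v|s].
- by apply: hlinearD; [apply: vM | apply: oM].
- by rewrite /curv vS oS scalerDr.
rewrite -[curv _ _ _]/(_ + _) vfieldE insertion_conv oprod_conv.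
apply: end_deg_lin.
  apply: conv_ind => [k x y|a b dab]; first exact: end_deg_lin.
  have := in_O_deg D_in (lam a :: b).
  rewrite sdeg_cons bk_deg -dab.
  have -> : 1 + (sdeg a + 1 + sdeg b) = 2 + (sdeg a + sdeg b) by ring.
  by move=> Dd; apply: end_degZ.
apply: conv_ind => [k x y|a b dab]; first exact: end_deg_lin.
have := end_deg_comp (in_O_deg D_in a) (in_O_deg D_in b).
have -> : 1 + sdeg a + (1 + sdeg b) = 2 + (sdeg a + sdeg b) by ring.
by rewrite dab => Dd; apply: end_degZ.
Qed.

(** The second Bianchi identity: the curvature [R = Q(D) + D D] commutes with
    [Q + D], since [Q] squares to zero and composition is associative. *)
Lemma Bianchi s :
  vfield lam (curv lam D) s + oprod (@lcomp K E) 1 D (curv lam D) s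
    - oprod (@lcomp K E) 2 (curv lam D) D s = 0.
Proof.
rewrite vfieldD (vfield_square _ _ charK0 DM DS) add0r.
rewrite (vfield_oprod lcompDl lcompDr _ _ (bk_deg lam) DS DS).
rewrite (oprodD_r _ _ _ _ _ lcompDr) (oprodD_l _ _ _ _ _ lcompDl).
rewrite (oprod_assoc (mu12 := @lcomp K E) (mu123 := @lcomp K E));
  [|exact: lcompDl|exact: lcompDr|by move=> x y z; rewrite /lcomp comp_lfunA].
rewrite ksign1 scaleN1r; set x := oprod _ _ _ _ _.
set y := oprod _ _ _ _ _; set z := oprod _ _ _ _ _.
by rewrite addrA subrK subrr.
Qed.

(** The square of [Q + D] is linear over the functions: the terms in [Q f]
    cancel. *)
Lemma square_curv f s :
  multilinear f -> gsymmetric f ->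
  vfield lam (fun t => vfield lam f t + oprod (@lapp K E) 1 D f t) s +
    oprod (@lapp K E) 1 D (fun t => vfield lam f t + oprod (@lapp K E) 1 D f t) s
  = oprod (@lapp K E) 2 (curv lam D) f s.
Proof.
move=> fM fS.
rewrite vfieldD (vfield_square _ _ charK0 fM fS) add0r.
rewrite (vfield_oprod lappDl lappDr _ _ (bk_deg lam) DS fS).
rewrite (oprodD_r _ _ _ _ _ lappDr) (oprodD_l _ _ _ _ _ lappDl).
rewrite (oprod_assoc (mu12 := @lcomp K E) (mu123 := @lapp K E));
  [|exact: lappDl|exact: lappDr|by move=> x y z; rewrite /lcomp /lapp comp_lfunE].
by rewrite ksign1 scaleN1r addrA subrK.
Qed.

End Curvature.

Arguments lcompDl {K E}.
Arguments lcompDr {K E}.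
Arguments lappDl {K E}.
Arguments lappDr {K E}.

(** * Maps of graded spaces *)

Lemma gpart_lfun_eq (K : fieldType) (E : gvect K) (W : vectType K)
    (phi psi : 'Hom(E, W)) :
  (forall d v, v \in gpart E d -> phi v = psi v) -> phi = psi.
Proof.
move=> phipsi; apply/lfunP => v; apply/eqP; rewrite -subr_eq0.
have : (fullv <= lker (phi - psi))%VS.
  rewrite -(gpart_span E).
  apply: (big_ind (fun X => (X <= lker (phi - psi))%VS)) => [|X Y ? ?|d _].
  - exact: sub0v.
  - by rewrite subv_add; apply/andP.
  apply/subvP => w wd.
  by rewrite memv_ker add_lfunE opp_lfunE (phipsi d) // subrr.
by move=> /subvP/(_ v (memvf v)); rewrite memv_ker add_lfunE opp_lfunE.
Qed.

Lemma in_O_map (K : fieldType) (V V' : gvect K) (U : {vspace V})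
    (U' : {vspace V'}) (W : lmodType K) (Wdeg : int -> W -> Prop) n
    (g : hvec U -> hvec U') f :
  (forall u, hdeg (g u) = hdeg u) -> hlinear (fun u => hval (g u)) ->
  in_O Wdeg n f -> in_O Wdeg n (fun s => f (map g s)).
Proof.
move=> gd gL [fM fS fD]; have gs s : sdeg (map g s) = sdeg s.
  by rewrite /sdeg big_map; apply: eq_bigr => u _; rewrite gd.
split=> [s1 s2 k u v w uw vw wE|s1 s2 u v|s].
- by rewrite !map_cat; apply: fM; rewrite ?gd //; apply: gL.
- by rewrite !map_cat /= fS !gd.
by rewrite -gs.
Qed.

(** * Restriction to the subalgebra *)

Section Pair.
Variables (K : fieldType) (P : shpair K).
Hypothesis charK0 : [pchar K] =i pred0.
Local Notation ksign := (ksign K).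
Local Notation L := (shL P).
Local Notation A := (shA P).
Implicit Types (s : seq (hvec A)) (l : hvec {:L}) (W : lmodType K).

Lemma sdeg_jseq s : sdeg (jseq s) = sdeg s.
Proof. by rewrite /sdeg big_map. Qed.

Lemma conv_jseq W (Phi : seq (hvec {:L}) -> seq (hvec {:L}) -> W) s :
  conv Phi (jseq s) = conv (fun a b => Phi (jseq a) (jseq b)) s.
Proof.
elim: s Phi => [|u s IHs] Phi; first by rewrite !conv_nil.
rewrite [jseq _]/= !conv_cons !IHs; congr (_ + _).
by apply: eq_conv => a b _ _; rewrite sdeg_jseq.
Qed.

Lemma hincl_shbkA s : hincl (shbkA s) = shbk P (jseq s).
Proof. exact: hvec_eq. Qed.

Lemma hincl_onto l : hval l \in A -> exists a : hvec A, hincl a = l.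
Proof.
move=> lA; have aP : hval l \in (gpart L (hdeg l) :&: A)%VS.
  by have := hvalP l; rewrite !memv_cap lA => /andP[->].
by exists (HVec aP); apply: hvec_eq.
Qed.

Lemma LinfA_deg s : hdeg (shbkA s) = sdeg s + 1.
Proof. by rewrite /= bk_deg sdeg_jseq. Qed.

Lemma LinfA_multi : multilinear (fun s => hval (shbkA s)).
Proof.
move=> s1 s2 k u v w uw vw wE; rewrite /= /jseq !map_cat.
exact: (bk_multi (shbk P)).
Qed.

Lemma LinfA_sym : gsymmetric (fun s => hval (shbkA s)).
Proof. by move=> s1 s2 u v; rewrite /= /jseq !map_cat; apply: (bk_sym (shbk P)). Qed.

Lemma LinfA_jacobi s :
  \sum_(x <- unshuffles s) x.1 *: hval (shbkA (shbkA x.2.1 :: x.2.2)) = 0.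
Proof.
have := conv_jseq (fun a b => hval (shbk P (shbk P a :: b))) s.
rewrite {1}/conv bk_jacobi => /esym; rewrite /conv => E; rewrite -[RHS]E.
by apply: eq_bigr => x _; rewrite -hincl_shbkA.
Qed.

Definition LinfA : Linf A := MkLinf LinfA_deg LinfA_multi LinfA_sym LinfA_jacobi.

Lemma jdual_QL W (f : seq (hvec {:L}) -> W) s : QL f (jseq s) = QA (jdual f) s.
Proof.
rewrite /QL /QA !vfield_conv conv_jseq sdeg_jseq; congr (_ *: _).
by apply: eq_conv => a b _ _; rewrite size_map -hincl_shbkA.
Qed.

Lemma jdual_oprod (W1 W2 W3 : lmodType K) (mu : W1 -> W2 -> W3) p F G s :
  oprod mu p F G (jseq s) = oprod mu p (fun t => F (jseq t)) (fun t => G (jseq t)) s.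
Proof.
rewrite !oprod_conv conv_jseq; apply: eq_conv => a b _ _.
by rewrite sdeg_jseq.
Qed.

(** If the distinguished argument also lies in [A], then all arguments do. *)
Lemma Jmap_in (E : gvect K) n (f : seq (hvec {:L}) -> 'End(E)) :
  in_O (@end_deg K E) n f -> (forall s, f (jseq s) = 0) ->
  in_O (perp_deg A (@end_deg K E)) n (Jmap f).
Proof.
move=> [fM fS fD] fA; split=> [s1 s2 k u v w uw vw wE|s1 s2 u v|s].
- apply/funext => l; rewrite /Jmap /deRham /jseq !map_cat.
  exact: (fM (l :: jseq s1)).
- apply/funext => l; rewrite /Jmap /deRham /jseq !map_cat.
  exact: (fS (l :: jseq s1)).
split; first split=> [|v].
- exact: (fM [::] (jseq s)).
- by have := fD (v :: jseq s); rewrite sdeg_cons sdeg_jseq addrA addrAC.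
by move=> v /hincl_onto[a <-]; apply: (fA (a :: s)).
Qed.

(** * [J] intertwines the connection with the differential *)

Lemma DperpE W (psi : hvec {:L} -> W) s l : Dperp psi s l =
  (ksign (hdeg l + sdeg s) * (-1) ^+ size s) *: psi (shbk P (l :: jseq s)).
Proof.
rewrite /Dperp /Jmap /deRham /QL vfield_linformE sdeg_cons sdeg_jseq /= size_map.
by congr (_ *: _); rewrite exprS !ksignD ksign1 mulrN1 mulN1r mulrNN.
Qed.

Lemma Dperp_extE W (X : seq (hvec A) -> hvec {:L} -> W) s l :
  Dperp_ext X s l = conv (fun a b => (ksign (sdeg a + sdeg a * sdeg b) *
    (ksign (hdeg l + sdeg b) * (-1) ^+ size b)) *: X a (shbk P (l :: jseq b))) s.
Proof.
rewrite /Dperp_ext /conv; apply: eq_bigr => x _.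
by rewrite DperpE !scalerA !mulrA.
Qed.

(** In [Q f] the terms where [l] is an argument of the bracket give the dual of
    the action on [L / A], and the others give the vector field of [A]. *)
Lemma J_QL W (f : seq (hvec {:L}) -> W) s l : gsymmetric f ->
  QL f (l :: jseq s) = QA (Jmap f) s l + Dperp_ext (Jmap f) s l.
Proof.
move=> fS; rewrite /QL vfieldE (insertion_cons _ _ (bk_deg _) fS).
rewrite !insertion_conv !conv_jseq scalerDr addrC; congr (_ + _).
  rewrite /QA vfield_app vfield_conv scalerA; congr (_ *: _).
    by rewrite sdeg_cons sdeg_jseq; sign_cases.
  apply: eq_conv => a b _ _; rewrite size_map /Jmap /deRham /=.
  by rewrite -?hincl_shbkA.
rewrite Dperp_extE conv_swap -!convZ; apply: eq_conv => a b dab _.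
rewrite !scalerA size_map sdeg_cons !sdeg_jseq -dab /Jmap /deRham.
by congr (_ *: _); sign_cases.
Qed.

Section Connection.
Variables (E : gvect K) (M : amodule P E).
Local Notation D := (mop M).

(** The terms in which [l] goes to the connection leave [f] with arguments in
    [A] only. *)
Lemma J_left (nabla : connection M) f s l : (forall t, f (jseq t) = 0) ->
  oprod (@lcomp K E) 1 (cop nabla) f (l :: jseq s) = Dleft M (Jmap f) s l.
Proof.
move=> fA; rewrite (oprod_cons lcompDl) !jdual_oprod.
rewrite (oprod_0r lcompDr) // add0r oprod_conv -convZ.
apply: eq_bigr => x _; rewrite -[RHS]scalerA; congr (_ *: _).
rewrite (muZl lcompDl) !scalerA sdeg_jseq.
rewrite -[cop nabla _]/(jdual (cop nabla) x.2.1) cop_ext.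
by congr (_ *: _); sign_cases.
Qed.

Lemma J_right (nabla : connection M) q f s l : (forall t, f (jseq t) = 0) ->
  oprod (@lcomp K E) q f (cop nabla) (l :: jseq s) = Dright M q (Jmap f) s l.
Proof.
move=> fA; rewrite (oprod_cons lcompDl) !jdual_oprod.
rewrite [X in _ + _ *: X](oprod_0l lcompDl) ?scaler0 ?addr0; last first.
  by move=> t; rewrite fA scaler0.
by apply: eq_oprod => // t; apply: (cop_ext nabla).
Qed.

(** Testing flatness on the constant cochains [1 (x) e]. *)
Lemma module_flat s : curv (@shbkA K P) D s = 0.
Proof.
apply: gpart_lfun_eq => d e ed; rewrite zero_lfunE.
pose f (t : seq (hvec A)) : E := if t is [::] then e else 0.
have f_in : in_O (@vect_deg K E) d f.
  split=> [[|? ?] s2 k u v w _ _ _|[|? ?] s2 u v|[|u t]] /=;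
    rewrite ?scaler0 ?addr0 // /vect_deg ?sdeg_nil ?addr0 ?mem0v //.
have sq := square_curv LinfA (mop_in M) charK0 s (in_O_multi f_in) (in_O_sym f_in).
have := etrans (esym sq) (mop_flat M f_in s).
rewrite oprod_conv => <-.
rewrite -(conv_unit (fun t => curv LinfA D t e)).
apply: eq_conv => a [|u b] _ _; last by rewrite /lapp linear0 scaler0.
by rewrite sdeg_nil mulr0 scale1r.
Qed.

Lemma curvature_jseq (nabla : connection M) s : curvature nabla (jseq s) = 0.
Proof.
rewrite /curvature jdual_QL jdual_oprod -[RHS](module_flat s) /curv.
have -> : jdual (cop nabla) = D by apply/funext => t; rewrite cop_ext.
by congr (_ + _); apply: eq_oprod => t; apply: (cop_ext nabla).
Qed.

Lemma atiyah_in (nabla : connection M) :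
  in_O (perp_deg A (@end_deg K E)) 2 (atiyah nabla).
Proof.
apply: Jmap_in (curvature_jseq nabla).
exact: (curv_in (shbk P) (cop_in nabla)).
Qed.

(** The image under [J] of the Bianchi identity. *)
Lemma atiyah_cocycle (nabla : connection M) :
  cocycle (CEperpEnd M) 2 (atiyah nabla).
Proof.
split; first exact: atiyah_in.
apply/funext => s; apply/funext => l.
have R0 := curvature_jseq nabla.
have RS := in_O_sym (curv_in (shbk P) (cop_in nabla)).
have := Bianchi (shbk P) (cop_in nabla) charK0 (l :: jseq s).
rewrite (J_left nabla _ _ R0) (J_right nabla 2 _ _ R0).
rewrite -[vfield _ _ (l :: _)]/(QL (curvature nabla) (l :: jseq s)) J_QL //.
by rewrite -addrA => R1; rewrite /= /dperpEnd [ksign 2]ksign_oddz scale1r.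
Qed.

(** If two connections differ by [delta], their curvatures differ by
    [Q delta + D' delta + delta D], whose image under [J] is the coboundary of
    the image of [delta]. *)
Lemma atiyah_difference (nabla nabla' : connection M) :
  exists2 c, cdeg (CEperpEnd M) 1 c &
    atiyah nabla' = atiyah nabla + cdiff (CEperpEnd M) 1 c.
Proof.
pose delta t := cop nabla' t + (-1) *: cop nabla t.
have delta0 s : delta (jseq s) = 0.
  rewrite /delta -[cop nabla _]/(jdual (cop nabla) s).
  rewrite -[cop nabla' _]/(jdual (cop nabla') s) !cop_ext.
  by rewrite scaleN1r subrr.
have [M1 S1 D1] := cop_in nabla; have [M2 S2 D2] := cop_in nabla'.
have delta_in : in_O (@end_deg K E) 1 delta.
  split=> [s1 s2|s1 s2 u v|s].
  - apply: (hlinearD (M2 s1 s2)).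
    exact: (hlinear_scale (fun=> -1) (M1 s1 s2)).
  - by rewrite /delta S1 S2 scalerDr !scalerA mulN1r mulrN1.
  by rewrite /delta [X in end_deg _ X]addrC; apply: end_deg_lin.
exists (Jmap delta); first exact: Jmap_in.
apply/funext => s; apply/funext => l.
rewrite -[RHS]/(atiyah nabla s l + dperpEnd M 1 (Jmap delta) s l).
rewrite /dperpEnd -(J_left nabla' _ _ delta0) -(J_right nabla 1 _ _ delta0).
rewrite -J_QL ?ksign1; last exact: in_O_sym delta_in.
rewrite scaleN1r opprK /atiyah /Jmap /deRham /curvature.
rewrite /QL vfieldD vfieldZ scaleN1r.
rewrite (oprodD_r _ _ _ _ _ lcompDr) (oprodD_l _ _ _ _ _ lcompDl).
rewrite (oprodZr lcompDr) (oprodZl lcompDl) !scaleN1r.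
set a := vfield _ _ _; set b := vfield _ _ _.
set x := oprod _ _ _ _ _; set z := oprod _ _ _ _ _; set y := oprod _ _ _ _ _.
by rewrite [x - y + _]addrA subrK [a - b + _]addrACA -opprD [RHS]addrC subrK.
Qed.

(** A connection is obtained by precomposing the module operator with a graded
    linear projection of [L] onto [A]. *)
Lemma hprojA_subproof l :
  projv (gpart L (hdeg l) :&: A) (hval l) \in (gpart L (hdeg l) :&: A)%VS.
Proof. exact: memv_proj. Qed.

Definition hprojA l : hvec A := HVec (hprojA_subproof l).

Lemma hprojA_linear : hlinear (fun l => hval (hprojA l)).
Proof. by move=> k u v w uw vw wE; rewrite /= uw vw wE linearP. Qed.

Lemma hprojA_incl s : map hprojA (jseq s) = s.
Proof.
rewrite /jseq -map_comp -[RHS]map_id; apply: eq_map => a /=.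
by apply: hvec_eq; rewrite //= projv_id // hvalP.
Qed.

Lemma projection_connection_ext s : jdual (fun t => D (map hprojA t)) s = D s.
Proof. by rewrite /jdual hprojA_incl. Qed.

Definition projection_connection : connection M :=
  Connection (in_O_map (g := hprojA) (fun=> erefl) hprojA_linear (mop_in M))
    projection_connection_ext.

(** * Canonicity of the class *)

Lemma dperpEndD q X Y s l :
  dperpEnd M q (X + Y) s l = dperpEnd M q X s l + dperpEnd M q Y s l.
Proof.
have QAD : QA (X + Y) s l = QA X s l + QA Y s l.
  by rewrite -[LHS]/(vfield _ (fun t => X t + Y t) s l) vfieldD.
have DperpD : Dperp_ext (X + Y) s l = Dperp_ext X s l + Dperp_ext Y s l.
  rewrite !Dperp_extE -convD; apply: eq_conv => a b _ _.
  by rewrite -scalerDr.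
have DleftD : Dleft M (X + Y) s l = Dleft M X s l + Dleft M Y s l.
  rewrite /Dleft -big_split; apply: eq_bigr => x _.
  by rewrite -[RHS]scalerDr /lcomp -comp_lfunDr.
have DrightD : Dright M q (X + Y) s l = Dright M q X s l + Dright M q Y s l.
  exact: (oprodD_l _ _ _ _ _ lcompDl).
rewrite /dperpEnd QAD DperpD DleftD DrightD scalerDr opprD.
rewrite (addrACA (QA X s l)) (addrACA (Dleft M X s l)).
exact: addrACA.
Qed.

Lemma cdegD n (X Y : CEperpEnd M) :
  cdeg (CEperpEnd M) n X -> cdeg (CEperpEnd M) n Y ->
  cdeg (CEperpEnd M) n (X + Y).
Proof.
move=> [XM XS XD] [YM YS YD]; split=> [s1 s2|s1 s2 u v|s].
- exact: hlinearD (XM s1 s2) (YM s1 s2).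
- by rewrite -[LHS]/(X _ + Y _) XS YS -scalerDr.
have [[X1 X2] X3] := XD s; have [[Y1 Y2] Y3] := YD s.
split; first split.
- exact: hlinearD X1 Y1.
- move=> v; rewrite -[(X + Y) s v]scale1r -[(X + Y) s v]/(X s v + Y s v) scale1r.
  by rewrite -[X s v]scale1r; apply: end_deg_lin.
by move=> v vA; rewrite -[LHS]/(X s v + Y s v) X3 // Y3 // addr0.
Qed.

Lemma atiyah_class_sub (nabla nabla' : connection M) :
  (cclass (CEperpEnd M) 2 (atiyah nabla') `<=`
     cclass (CEperpEnd M) 2 (atiyah nabla))%classic.
Proof.
have [c0 c0_in ->] := atiyah_difference nabla nabla'.
move=> _ [c c_in ->]; exists (c0 + c); first exact: cdegD.
rewrite -addrA; congr (_ + _); apply/esym.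
by apply/funext => s; apply/funext => l; apply: dperpEndD.
Qed.

(** The condition on [h] quantifies over all connections, so that uniqueness
    requires the existence of one of them. *)
Lemma atiyah_class_unique :
  exists! h : set (CEperpEnd M), is_atiyah_class h.
Proof.
pose nabla0 := projection_connection.
exists (cclass (CEperpEnd M) 2 (atiyah nabla0)); split; last first.
  by move=> h [_ hE]; apply: hE.
split; first by exists (atiyah nabla0); first exact: atiyah_cocycle.
by move=> nabla; apply/seteqP; split; apply: atiyah_class_sub.
Qed.

End Connection.
End Pair.

(** * Homogeneous decompositions *)

Section Homogeneous.
Variables (K : fieldType) (E : gvect K).

Lemma sum_delta (I : eqType) (M : nmodType) (r : seq I) (d : I) (x : M) :
  uniq r -> (d \notin r -> x = 0) ->
  \sum_(e <- r) (if e == d then x else 0) = x.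
Proof.
move=> r_uniq x0; have [dr|/[dup] dr /x0 ->] := boolP (d \in r).
  by rewrite (bigD1_seq d) //= eqxx big1 ?addr0 // => e /negPf ->.
by apply: big1 => e _; case: eqP.
Qed.

Lemma homog_decomp (v : E) : exists w : int -> E,
  (forall d, w d \in gpart E d) /\ v = \sum_(d <- gsupp E) w d.
Proof.
have : v \in (\sum_(d <- gsupp E) gpart E d)%VS by rewrite gpart_span memvf.
elim: (gsupp E) (gsupp_uniq E) v => [|d r IHr] /= => [_|/andP[dr r_uniq]] v.
  rewrite big_nil memv0 => /eqP ->; exists (fun=> 0).
  by split=> [d|]; rewrite ?mem0v ?big_nil.
rewrite big_cons => /memv_addP[x xd [y /(IHr r_uniq)[w [wP ->]] ->]].
exists (fun e => if e == d then x else w e).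
split=> [e|]; first by case: eqP => [->|_].
rewrite big_cons eqxx; congr (_ + _); apply: eq_big_seq => e er.
by case: eqP => // ed; rewrite -ed er in dr.
Qed.

Lemma homog_free (r : seq int) (u : int -> E) : uniq r ->
  (forall d, u d \in gpart E d) -> \sum_(d <- r) u d = 0 ->
  forall d, d \in r -> u d = 0.
Proof.
move=> r_uniq uP u0 d dr.
have [ds|/gpart_out ds] := boolP (d \in gsupp E); last first.
  by have := uP d; rewrite ds memv0 => /eqP.
pose u' e := if e \in r then u e else 0.
have := @gpart_free _ E u' _ _ d ds; rewrite /u' dr; apply.
  by move=> e; case: ifP; rewrite ?mem0v.
rewrite -big_mkcond -big_filter; apply: etrans u0.
rewrite [RHS](bigID (mem (gsupp E))) /= [X in _ + X]big1 ?addr0; last first.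
  by move=> e /gpart_out e0; have := uP e; rewrite e0 memv0 => /eqP.
rewrite -[in RHS]big_filter; apply: perm_big; apply: uniq_perm.
- exact/filter_uniq/gsupp_uniq.
- exact: filter_uniq.
by move=> e; rewrite !mem_filter andbC.
Qed.

Lemma homog_unique (v w : int -> E) :
  (forall d, v d \in gpart E d) -> (forall d, w d \in gpart E d) ->
  \sum_(d <- gsupp E) v d = \sum_(d <- gsupp E) w d ->
  forall d, d \in gsupp E -> v d = w d.
Proof.
move=> vP wP vw d ds; apply/eqP; rewrite -subr_eq0; apply/eqP.
apply: (@homog_free (gsupp E) (fun e => v e - w e)) => //.
- exact: gsupp_uniq.
- by move=> e; apply: memvB.
by rewrite sumrB vw subrr.
Qed.

Lemma homog_subproof d (x : E) : x \in gpart E d -> x \in (gpart E d :&: fullv)%VS.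
Proof. by rewrite memv_cap memvf andbT. Qed.

(** The extension is the sum of the values on the homogeneous components; it is
    linear because the components are unique. *)
Lemma hlinear_extend (W : vectType K) (g : hvec {:E} -> W) : hlinear g ->
  exists phi : 'Hom(E, W), forall u, phi (hval u) = g u.
Proof.
move=> gL; pose w v := projT1 (cid (homog_decomp v)).
have wP v d : w v d \in gpart E d.
  by rewrite /w; case: cid => x [xP xs] /=.
have wE v : v = \sum_(d <- gsupp E) w v d.
  by rewrite /w; case: cid => x [xP xs] /=.
pose phi v := \sum_(d <- gsupp E) g (HVec (homog_subproof (wP v d))).
have phiL : linear phi.
  move=> k u v; rewrite scaler_sumr -big_split; apply: eq_big_seq => d ds /=.
  apply: gL => //=.
  apply: (homog_unique (w := fun e => k *: w u e + w v e)) => // [e|].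
    by apply: memvD => //; apply: memvZ.
  by rewrite big_split -scaler_sumr /= -!wE.
pose phim := GRing.isLinear.Build _ _ _ _ phi phiL.
pose phil : {linear E -> W} := HB.pack phi phim.
exists (linfun phil) => u; rewrite lfunE /= /phi.
have ws e : e \in gsupp E ->
    w (hval u) e = if e == hdeg u then hval u else 0.
  have uP := hvalP u; rewrite memv_cap memvf andbT in uP.
  apply: (homog_unique (w := fun e => if e == hdeg u then hval u else 0)).
  - exact: wP.
  - by move=> d; case: eqP => [->|_]; rewrite ?mem0v.
  rewrite -wE sum_delta ?gsupp_uniq // => /gpart_out u0.
  by move: uP; rewrite u0 memv0 => /eqP.
rewrite -[RHS](@sum_delta _ _ (gsupp E) (hdeg u)) ?gsupp_uniq; last first.
- move=> /gpart_out u0; apply: (hlinear0 gL).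
  by have := hvalP u; rewrite u0 cap0v memv0 => /eqP.
- by [].
apply: eq_big_seq => e es; have := ws e es; case: eqP => [eu|_] we.
  by congr g; apply: hvec_eq.
exact: (hlinear0 gL).
Qed.

End Homogeneous.

(** * The quotient and its canonical module structure *)

Section QuotientModule.
Variables (K : fieldType) (P : shpair K) (B : gvect K) (p : quotient P B).
Hypothesis charK0 : [pchar K] =i pred0.
Local Notation ksign := (ksign K).
Local Notation L := (shL P).
Local Notation A := (shA P).
Implicit Types (s : seq (hvec A)) (l : hvec {:L}).

(** Any preimage decomposes into homogeneous components, whose images are the
    components of the given vector. *)
Lemma hproj_onto (b : hvec {:B}) : exists l, hproj p l = b.
Proof.
have bP := hvalP b; rewrite memv_cap memvf andbT in bP.
have /memv_imgP[x _ bx] : hval b \in limg (qproj p).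
  by rewrite qproj_surj memvf.
have [w [wP xw]] := homog_decomp x; set d := hdeg b in bP.
have pw e : qproj p (w e) \in gpart B e.
  by apply: (subvP (qproj_deg p e)); apply: memv_img.
suff pwd : qproj p (w d) = hval b.
  by exists (HVec (homog_subproof (wP d))); apply: hvec_eq.
pose u e := qproj p (w e) - (if e == d then hval b else 0).
have uP e : u e \in gpart B e.
  by apply: memvB => //; case: eqP => [->|_]; rewrite ?mem0v.
have sum_pw : \sum_(e <- gsupp L) qproj p (w e) = hval b.
  by rewrite bx xw linear_sum.
apply/eqP; rewrite -subr_eq0; apply/eqP.
have ud : u d = qproj p (w d) - hval b by rewrite /u eqxx.
rewrite -ud; have [ds|ds] := boolP (d \in gsupp L).
  apply: (homog_free (gsupp_uniq L) uP) => //.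
  rewrite sumrB sum_pw sum_delta ?subrr ?gsupp_uniq //.
  by rewrite ds.
apply: (homog_free (r := d :: gsupp L) _ uP); rewrite ?mem_head //=.
  by rewrite ds gsupp_uniq.
have b0 : \sum_(e <- gsupp L) (if e == d then hval b else 0) = 0.
  rewrite big_seq; apply: big1 => e es.
  by case: eqP => // ed; rewrite -ed es in ds.
rewrite big_cons ud sumrB sum_pw b0 subr0 subrK.
by have := wP d; rewrite (gpart_out ds) memv0 => /eqP ->; rewrite linear0.
Qed.

Definition lift (b : hvec {:B}) : hvec {:L} := projT1 (cid (hproj_onto b)).

Lemma liftK (b : hvec {:B}) : hproj p (lift b) = b.
Proof. by rewrite /lift; case: cid. Qed.

Lemma hdeg_lift (b : hvec {:B}) : hdeg (lift b) = hdeg b.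
Proof. by rewrite -{2}(liftK b). Qed.

Lemma qproj_lift (b : hvec {:B}) : qproj p (hval (lift b)) = hval b.
Proof. by rewrite -{2}(liftK b). Qed.

Lemma qproj_eq0 l : (qproj p (hval l) == 0) = (hval l \in A).
Proof. by rewrite -memv_ker qproj_ker. Qed.

Lemma gpart_onto d x : x \in gpart B d ->
  exists2 l : hvec {:L}, hdeg l = d & qproj p (hval l) = x.
Proof.
move=> xd; exists (lift (HVec (homog_subproof xd))); first by rewrite hdeg_lift.
by rewrite qproj_lift.
Qed.

Lemma descend_eq (W : lmodType K) (psi : hvec {:L} -> W) l l' :
  hlinear psi -> (forall v, hval v \in A -> psi v = 0) ->
  hproj p l = hproj p l' -> psi l = psi l'.
Proof.
move=> psiL psiA ll'.
have dl : hdeg l = hdeg l' by rewrite -[LHS]/(hdeg (hproj p l)) ll'.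
have vl : qproj p (hval l) = qproj p (hval l').
  by rewrite -[LHS]/(hval (hproj p l)) ll'.
have := psiL (-1) l l' (hlin (-1) l l') erefl (esym dl) (hlinE _ (esym dl)).
rewrite psiA; first by rewrite scaleN1r addrC => /esym/eqP; rewrite subr_eq0 => /eqP.
by rewrite -qproj_eq0 hlinE // linearP /= vl scaleN1r addNr.
Qed.

Lemma descend_linear (W : lmodType K) (psi : hvec {:L} -> W) :
  hlinear psi -> (forall v, hval v \in A -> psi v = 0) ->
  hlinear (fun b => psi (lift b)).
Proof.
move=> psiL psiA k u v w uw vw wE.
have duv : hdeg (lift v) = hdeg (lift u) by rewrite !hdeg_lift uw vw.
rewrite (descend_eq (l := lift w) (l' := hlin k (lift u) (lift v)) psiL psiA).
  by apply: psiL => //; apply: hlinE.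
rewrite liftK; apply: hvec_eq; first by rewrite /= hdeg_lift uw.
by rewrite -[RHS]/(qproj p (hval (hlin _ _ _))) hlinE // linearP /= !qproj_lift.
Qed.

(** The action of [A] on [L / A], pulled back to [L]; as for
    [canonical_module], the sign makes it dual to [Dperp]. *)
Definition bracket_act s l : B :=
  (-1) ^+ size s *: qproj p (hval (shbk P (rcons (jseq s) l))).

Lemma bracket_act_linear s : hlinear (bracket_act s).
Proof.
move=> k u v w uw vw wE; rewrite /bracket_act -!cats1.
rewrite (bk_multi (shbk P) (jseq s) [::] uw vw wE) linearP.
by rewrite scalerDr !scalerA mulrC.
Qed.

Lemma bracket_act_A s v : hval v \in A -> bracket_act s v = 0.
Proof.
move=> /hincl_onto[a <-]; rewrite /bracket_act.
have -> : rcons (jseq s) (hincl a) = jseq (rcons s a) by rewrite /jseq map_rcons.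
have /eqP -> : qproj p (hval (shbk P (jseq (rcons s a)))) == 0.
  by rewrite qproj_eq0 shA_closed.
by rewrite scaler0.
Qed.

Definition quotient_op s : 'End(B) :=
  projT1 (cid (hlinear_extend
    (descend_linear (@bracket_act_linear s) (@bracket_act_A s)))).

(** The choice of the lift does not matter, since brackets of elements of [A]
    die in the quotient. *)
Lemma quotient_opE s l : quotient_op s (qproj p (hval l)) = bracket_act s l.
Proof.
apply: etrans (projT2 (cid (hlinear_extend _)) (hproj p l)) _.
apply: (descend_eq (@bracket_act_linear s) (@bracket_act_A s)).
by rewrite liftK.
Qed.

Lemma quotient_op_in : in_O (@end_deg K B) 1 quotient_op.
Proof.
have bkM : multilinear (fun t => hval (shbk P t)) := bk_multi (shbk P).
split=> [s1 s2 k u v w uw vw wE|s1 s2 u v|s d].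
- apply: gpart_lfun_eq => d _ /gpart_onto[l _ <-].
  rewrite add_lfunE scale_lfunE !quotient_opE /bracket_act /jseq !map_cat.
  rewrite !rcons_cat /= (bkM _ _ k (hincl u) (hincl v)) // linearP.
  by rewrite !size_cat /= scalerDr !scalerA mulrC.
- apply: gpart_lfun_eq => d _ /gpart_onto[l _ <-].
  rewrite scale_lfunE !quotient_opE /bracket_act /jseq !map_cat !rcons_cat /=.
  rewrite (bk_sym (shbk P)) linearZ !size_cat /= !scalerA.
  by rewrite mulrC.
apply/subvP => _ /memv_imgP[x /gpart_onto[l ld <-] ->].
rewrite quotient_opE; apply: memvZ; apply: (subvP (qproj_deg p _)).
apply: memv_img; have := hvalP (shbk P (rcons (jseq s) l)).
rewrite memv_cap bk_deg -cats1 sdeg_cat sdeg_cons sdeg_nil sdeg_jseq addr0 ld.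
by rewrite addrAC addrC [1 + _]addrC => /andP[].
Qed.

Section CanonicalOperator.
Variable D : seq (hvec A) -> 'End(B).
Hypothesis DE : forall s l, D s (qproj p (hval l)) = bracket_act s l.

(** The form with [l] as first argument, which splits off in sums over
    unshuffles. *)
Lemma canonical_head s l : D s (qproj p (hval l)) =
  ((-1) ^+ size s * ksign (hdeg l * sdeg s)) *:
    qproj p (hval (shbk P (l :: jseq s))).
Proof.
rewrite DE /bracket_act (gsymmetric_rcons _ _ (bk_sym (shbk P))) sdeg_jseq.
by rewrite linearZ scalerA -mulrA ksignK mulr1.
Qed.

(** Flatness on [p(l)] is the Jacobi identity of [L] on [l] and arguments in
    [A]: the terms with [l] in the inner bracket give the square of the
    operator, the others its image under the vector field. *)
Lemma canonical_flat s : curv (@shbkA K P) D s = 0.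
Proof.
apply: gpart_lfun_eq => d _ /gpart_onto[l _ <-]; rewrite zero_lfunE.
rewrite /curv add_lfunE vfield_conv oprod_conv scale_lfunE.
rewrite !(conv_linear (g := fun phi : 'End(B) => phi (qproj p (hval l))));
  try by move=> k x y; rewrite add_lfunE scale_lfunE.
have := bk_jacobi (shbk P) (l :: jseq s).
rewrite -[LHS]/(conv (fun a b => hval (shbk P (shbk P a :: b))) (l :: jseq s)).
rewrite conv_cons !conv_jseq => /(congr1 (qproj p)).
rewrite linear0 linearD /= !(conv_linear (g := qproj p));
  try by move=> k x y; rewrite linearP.
move=> /(congr1 ( *:%R (ksign (sdeg s * (hdeg l + 1)) * (-1) ^+ size s))).
rewrite scaler0 scalerDr => J0; rewrite -[RHS]J0 addrC -!convZ; congr (_ + _).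
  rewrite conv_swap; apply: eq_conv => a b dab sab.
  rewrite scale_lfunE /lcomp comp_lfunE (canonical_head a).
  rewrite [D b _]linearZ /= canonical_head.
  rewrite bk_deg sdeg_cons sdeg_jseq !scalerA -dab -sab; congr (_ *: _).
  by sign_cases.
apply: eq_conv => a b dab sab.
rewrite scale_lfunE canonical_head /= hincl_shbkA (bk_sym (shbk P) [::]) /=.
rewrite ![qproj p _]linearZ !scalerA sdeg_cons /= bk_deg !sdeg_jseq -dab -sab.
congr (_ *: _).
by sign_cases.
Qed.

End CanonicalOperator.

Lemma quotient_op_square n f : in_O (@vect_deg K B) n f ->
  forall s, dmod quotient_op (dmod quotient_op f) s = 0.
Proof.
move=> [fM fS _] s.
have sq := square_curv (LinfA P) quotient_op_in charK0 s fM fS.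
rewrite -[LHS]/(vfield (LinfA P) _ s + oprod _ _ _ _ _) [LHS]sq.
apply: (oprod_0l lappDl); exact: (canonical_flat quotient_opE).
Qed.

Definition quotient_module : amodule P B :=
  AModule quotient_op_in quotient_op_square.

Lemma quotient_module_canonical : canonical_module p quotient_module.
Proof. by move=> s l; apply: quotient_opE. Qed.

(** * The two models of the coefficients *)

Variable M : amodule P B.
Hypothesis canM : canonical_module p M.
Local Notation D := (mop M).
Local Notation Phi := (@HomBB_perpEnd K P B M p).

Lemma HomBB_perpEnd_in n Y :
  cdeg (CEHomBB M) n Y -> cdeg (CEperpEnd M) n (Phi n Y).
Proof.
move=> [YM YS YD]; split=> [s1 s2 k u v w uw vw wE|s1 s2 u v|s].
- apply/funext => l; rewrite -[RHS]/(k *: Phi n Y _ l + Phi n Y _ l).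
  rewrite /HomBB_perpEnd (YM s1 s2 k u v w) // -[(_ + _) _]/(k *: Y _ _ + Y _ _).
  by rewrite !sdeg_cat !sdeg_cons uw vw scalerDr !scalerA (mulrC k).
- apply/funext => l; rewrite -[RHS]/(_ *: Phi n Y _ l).
  rewrite /HomBB_perpEnd (YS s1 s2) -[(_ *: _) _]/(_ *: Y _ _) !scalerA.
  by rewrite !sdeg_cat !sdeg_cons (addrCA (hdeg u)) mulrC.
have [YL Yd] := YD s; split; first split.
- apply: (hlinear_scale (psi := fun l => Y s (hproj p l))
    (fun d => ksign ((n + sdeg s + d) * d))).
  move=> k u v w uw vw wE; apply: YL => //=.
  by rewrite wE linearP.
- by move=> v; apply: end_degZ; apply: (Yd (hproj p v)).
move=> v; rewrite -qproj_eq0 => /eqP v0.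
by rewrite /HomBB_perpEnd (hlinear0 YL) ?scaler0.
Qed.

(** The inverse evaluates on a lift of the first argument. *)
Lemma HomBB_perpEnd_bij n :
  set_bij (cdeg (CEHomBB M) n) (cdeg (CEperpEnd M) n) (Phi n).
Proof.
split; first exact: HomBB_perpEnd_in.
- move=> Y Y' _ _ YY'; apply/funext => s; apply/funext => b.
  have := congr1 (fun X : CEperpEnd M => X s (lift b)) YY'.
  rewrite /HomBB_perpEnd liftK => /(congr1 ( *:%R
    (ksign ((n + sdeg s + hdeg (lift b)) * hdeg (lift b))))).
  by rewrite !scalerA ksignK !scale1r.
move=> X X_in; have [XM XS XD] := X_in.
pose Y : CEHomBB M :=
  fun s b => ksign ((n + sdeg s + hdeg b) * hdeg b) *: X s (lift b).
exists Y; last first.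
  apply/funext => s; apply/funext => l; have [[XL _] XA] := XD s.
  rewrite /HomBB_perpEnd /Y scalerA ksignK scale1r.
  by apply: (descend_eq XL XA); rewrite liftK.
split=> [s1 s2 k u v w uw vw wE|s1 s2 u v|s].
- apply/funext => b; rewrite -[RHS]/(k *: Y _ b + Y _ b).
  rewrite /Y (XM s1 s2 k u v w) // -[(_ + _) _]/(k *: X _ _ + X _ _).
  by rewrite !sdeg_cat !sdeg_cons uw vw scalerDr !scalerA (mulrC k).
- apply/funext => b; rewrite -[RHS]/(_ *: Y _ b).
  rewrite /Y (XS s1 s2) -[(_ *: _) _]/(_ *: X _ _) !scalerA.
  by rewrite !sdeg_cat !sdeg_cons (addrCA (hdeg u)) mulrC.
have [[XL Xd] XA] := XD s; split.
  apply: (hlinear_scale (psi := fun b => X s (lift b))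
    (fun d => ksign ((n + sdeg s + d) * d))).
  exact: descend_linear.
by move=> b; apply: end_degZ; rewrite -hdeg_lift; apply: Xd.
Qed.

Lemma hact_hproj (W : lmodType K) (psi : hvec {:B} -> W) s l : hlinear psi ->
  psi (hact M s (hproj p l)) = ((-1) ^+ size s * ksign (hdeg l * sdeg s)) *:
    psi (hproj p (shbk P (l :: jseq s))).
Proof.
move=> psiL; apply: (hlinearZ psiL).
  by rewrite /= bk_deg sdeg_cons sdeg_jseq; ring.
by rewrite /= (canonical_head canM).
Qed.

(** Term by term: composition on the left and the vector field correspond to
    themselves, the action on the first argument to the dual action on the
    annihilator of [A], and the action on the second argument to composition on
    the right. *)
Lemma HomBB_perpEnd_diff n Y : cdeg (CEHomBB M) n Y ->
  Phi (n + 1) (cdiff (CEHomBB M) n Y) = cdiff (CEperpEnd M) n (Phi n Y).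
Proof.
move=> [YM YS YD]; apply/funext => s; apply/funext => l.
rewrite -[LHS]/(ksign ((n + 1 + sdeg s + hdeg l) * hdeg l) *:
  dHomBB M n Y s (hproj p l)).
rewrite -[RHS]/(dperpEnd M n (Phi n Y) s l) /dperpEnd /dHomBB.
set c := ksign ((n + 1 + _ + _) * _).
(* Separate the actions on the first and on the second argument. *)
have -> : \sum_(x <- unshuffles s) (x.1 * ksign (n * sdeg x.2.2)) *:
    (Y x.2.1 (hact M x.2.2 (hproj p l)) +
     ksign ((1 + sdeg x.2.2) * hdeg (hproj p l)) *:
       lcomp (Y x.2.1 (hproj p l)) (D x.2.2)) =
  conv (fun a b => ksign (n * sdeg b) *: Y a (hact M b (hproj p l))) s +
  conv (fun a b => ksign (n * sdeg b) *: (ksign ((1 + sdeg b) * hdeg l) *: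
       lcomp (Y a (hproj p l)) (D b))) s.
  rewrite -convD; apply: eq_bigr => x _.
  by rewrite -scalerDr scalerA.
have <- : c *: QA Y s (hproj p l) = QA (Phi n Y) s l.
  rewrite /QA !vfield_app !vfield_conv scalerA mulrC -scalerA -convZ; congr (_ *: _).
  apply: eq_conv => a b dab _; rewrite /HomBB_perpEnd !scalerA sdeg_cons.
  rewrite -[hdeg (shbkA a)]/(hdeg (LinfA P a)) bk_deg /c -dab.
  by congr (_ *: _); sign_cases.
have <- : c *: oprod (@lcomp K B) 1 D (fun t => Y t (hproj p l)) s =
    Dleft M (Phi n Y) s l.
  rewrite oprod_conv -convZ.
  transitivity (conv (fun a b => ksign (sdeg b + (1 + sdeg a) * hdeg l) *:
      lcomp (D a) (Phi n Y b l)) s); last first.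
    by apply: eq_bigr => x _; rewrite scalerA.
  apply: eq_conv => a b dab _; rewrite /HomBB_perpEnd (muZr lcompDr) !scalerA.
  by rewrite /c -dab; congr (_ *: _); sign_cases.
have <- : - (c *: (ksign n *:
      conv (fun a b => ksign (n * sdeg b) *: Y a (hact M b (hproj p l))) s)) =
    Dperp_ext (Phi n Y) s l.
  rewrite Dperp_extE -scaleN1r -!convZ; apply: eq_conv => a b dab _.
  have [YL _] := YD a.
  rewrite (hact_hproj _ _ YL) /HomBB_perpEnd !scalerA bk_deg sdeg_cons sdeg_jseq.
  by rewrite /c -dab; congr (_ *: _); sign_cases.
have <- : c *: conv (fun a b => ksign (n * sdeg b) *:
      (ksign ((1 + sdeg b) * hdeg l) *: lcomp (Y a (hproj p l)) (D b))) s =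
    Dright M n (Phi n Y) s l.
  rewrite /Dright oprod_conv -convZ; apply: eq_conv => a b dab _.
  rewrite /HomBB_perpEnd (muZl lcompDl) !scalerA.
  by rewrite /c -dab; congr (_ *: _); sign_cases.
move: (QA _ _ _) (oprod _ _ _ _ _) (conv _ _) (conv _ _) => x y z t.
by rewrite scalerBr !scalerDr !scalerA (mulrC c) opprD addrACA.
Qed.

Lemma HomBB_perpEnd_iso : cochains_iso Phi.
Proof.
move=> n; split; [|exact: HomBB_perpEnd_bij|exact: HomBB_perpEnd_diff].
move=> k X Y; apply/funext => s; apply/funext => l.
rewrite -[RHS]/(k *: Phi n X s l + Phi n Y s l) /HomBB_perpEnd.
rewrite -[(_ + _) s _]/(k *: X s _ + Y s _).
by rewrite scalerDr !scalerA (mulrC k).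
Qed.

End QuotientModule.

Theorem mainTheorem1 (K : fieldType) (charK0 : [pchar K] =i pred0)
    (P : shpair K) :
  (forall (E : gvect K) (M : amodule P E),
     (forall nabla : connection M,
        cocycle (CEperpEnd M) 2 (atiyah nabla)) /\
     exists! h : set (CEperpEnd M), is_atiyah_class h) /\
  (forall (B : gvect K) (p : quotient P B),
     (exists M : amodule P B, canonical_module p M) /\
     forall M : amodule P B, canonical_module p M ->
       (exists! h : set (CEperpEnd M), is_atiyah_class h) /\
       cochains_iso (HomBB_perpEnd (M := M) p)).
Proof.
split=> [E M|B p].
  split=> [nabla|]; first exact: atiyah_cocycle.
  exact: atiyah_class_unique.
split; first by exists (quotient_module p charK0); apply: quotient_module_canonical.
move=> M canM; split; first exact: atiyah_class_unique.
exact: HomBB_perpEnd_iso.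
Qed.
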